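(* Let $C>0$ and $0<a_1\le a_2\le\cdots$ with $a_i\to\infty$. For each $n$ let $m=m(n)\ge n$ be an integer, put $v_k=1/k$, and let $\Theta=\Theta(C)=\{\theta\in\mathbb R^n:\sum_{i=1}^na_i^2\theta_i^2\le C\}$. For each $n$ let $\tilde\lambda$ (depending on $n$) be a solution of $$\sum_{i=1}^n a_i^2\left[(v_n-v_{n+m})\sqrt{1+\frac{4\tilde\lambda/a_i^2}{v_n-v_{n+m}}}-(v_n+v_{n+m})\right]_+=2C,$$ and for $i=1,\dots,n$ let $$\tilde\theta_i^2=\frac12\left[(v_n-v_{n+m})\sqrt{1+\frac{4\tilde\lambda/a_i^2}{v_n-v_{n+m}}}-(v_n+v_{n+m})\right]_+ ,\qquad \tilde\theta_i^4=(\tilde\theta_i^2)^2.$$ If $m=O(n)$ and $$\log(1/v_n)\sum_{i=1}^na_i^4\tilde\theta_i^4=o(1)\quad\text{as } v_n\to0 \text{ (i.e. } n\to\infty),$$ then $$\lim_{v_n\to0}\frac{R(\Theta)}{R_L(\Theta)}=1,$$ where $R(\Theta)$ is the minimax risk over all predictive densities and $R_L(\Theta)$ the minimax risk over the linear predictive densities $\hat p_S$, both defined in the context.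
   Context: Notation: $[x]_+=\max(x,0)$. Gaussian sequence model: given $\theta\in\mathbb R^n$, $X\sim N(\theta,v_nI_n)$ and $\tilde X\sim N(\theta,v_mI_n)$ are independent, with $v_n=1/n$, $v_m=1/m$; $p(x\mid\theta)$ and $p(\tilde x\mid\theta)$ denote their densities. A predictive density $\hat p(\tilde x\mid x)$ is a non-negative (measurable) function integrating to 1 in $\tilde x\in\mathbb R^n$ for each $x\in\mathbb R^n$. Its average Kullback--Leibler risk is $$R(\theta,\hat p)=\frac1m E_{X,\tilde X\mid\theta}\log\frac{p(\tilde X\mid\theta)}{\hat p(\tilde X\mid X)}.$$ The overall minimax risk is $R(\Theta)=\inf_{\hat p}\sup_{\theta\in\Theta(C)}R(\theta,\hat p)$, the infimum being over all predictive densities. For $S=\mathrm{diag}(s_1,\dots,s_n)$ with $s_i\ge0$, let $\pi_S=N(0,S)$ on $\mathbb R^n$ (a coordinate with $s_i=0$ is a point mass at 0), and $$\hat p_S(\tilde x\mid x)=\frac{\int_{\mathbb R^n}p(x\mid\theta)p(\tilde x\mid\theta)\,\pi_S(d\theta)}{\int_{\mathbb R^n}p(x\mid\theta)\,\pi_S(d\theta)} .$$ The linear minimax risk is $R_L(\Theta)=\inf_S\sup_{\theta\in\Theta(C)}R(\theta,\hat p_S)$, the infimum being over all such $S$. *)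

(* Defs.v *)
From HB Require Import structures.
From mathcomp Require Import all_boot all_order all_algebra.
From mathcomp Require Import all_classical all_reals all_analysis.

Set Implicit Arguments.
Unset Strict Implicit.
Unset Printing Implicit Defensive.

Import Order.TTheory GRing.Theory Num.Theory.
Import numFieldNormedType.Exports.

Local Open Scope classical_set_scope.
Local Open Scope ring_scope.

(* Finite products of sigma-finite measures, on the library's product
   sigma-algebra over n-tuples. *)
Section tuple_measure.
Context d (T : measurableType d) (R : realType).

Definition cons_pair n (x : T * n.-tuple T) : n.+1.-tuple T :=
  [the n.+1.-tuple T of x.1 :: x.2].

Lemma measurable_cons_pair n : measurable_fun setT (@cons_pair n).
Proof. exact: measurable_cons. Qed.

Definition cons_measure n (m1 : {sigma_finite_measure set T -> \bar R})
    (m2 : {sigma_finite_measure set n.-tuple T -> \bar R}) :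
    set (n.+1.-tuple T) -> \bar R :=
  pushforward (m1 \x m2)%E (@cons_pair n).

Section cons_measure_instances.
Variables (n : nat) (m1 : {sigma_finite_measure set T -> \bar R}).
Variable m2 : {sigma_finite_measure set n.-tuple T -> \bar R}.

Let mcons : {measure set (n.+1.-tuple T) -> \bar R} :=
  measure_function_pushforward__canonical__measure_function_Measure
    (m1 \x m2)%E (@measurable_cons_pair n).

Let cons_measure0 : cons_measure m1 m2 set0 = 0%E.
Proof. exact: (measure0 mcons). Qed.

Let cons_measure_ge0 A : (0 <= cons_measure m1 m2 A)%E.
Proof. exact: (measure_ge0 mcons). Qed.

Let cons_measure_sigma_additive : semi_sigma_additive (cons_measure m1 m2).
Proof. exact: (@measure_semi_sigma_additive _ _ _ mcons). Qed.

HB.instance Definition _ := isMeasure.Build _ _ _ (cons_measure m1 m2)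
  cons_measure0 cons_measure_ge0 cons_measure_sigma_additive.

Lemma cons_measure_sigma_finite : sigma_finite setT (cons_measure m1 m2).
Proof.
have /sigma_finiteP[F [TF ndF Foo]] := sigma_finiteT m1.
have /sigma_finiteP[G [TG ndG Goo]] := sigma_finiteT m2.
pose g (t : n.+1.-tuple T) : T * n.-tuple T := (thead t, [tuple of behead t]).
have mg : measurable_fun setT g.
  apply: measurable_fun_pair; first exact: measurable_tnth.
  exact: measurable_behead.
have Kg x : g (cons_pair x) = x.
  by case: x => x t; congr pair => //; apply: val_inj.
exists (fun k => g @^-1` (F k `*` G k)).
  rewrite -preimage_bigcup -[LHS](preimage_setT g) -setXTT TF TG; congr preimage.
  apply/seteqP; split=> [[x y] [/= [i _ Fix] [j _ Gjy]]|[x y] [i _ []/= ? ?]].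
    exists (maxn i j) => //; split => /=.
      by move: x Fix; exact/subsetPset/ndF/leq_maxl.
    by move: y Gjy; exact/subsetPset/ndG/leq_maxr.
  by split; exists i.
move=> k; have [mF fF] := Foo k; have [mG fG] := Goo k; split.
  by rewrite -[X in measurable X]setTI; apply: mg => //; exact: measurableX.
rewrite /cons_measure /pushforward.
have -> : @cons_pair n @^-1` (g @^-1` (F k `*` G k)) = F k `*` G k.
  by rewrite -comp_preimage; apply/seteqP; split => x; rewrite /preimage/mkset/comp Kg.
by rewrite product_measure1E// lte_mul_pinfty// ge0_fin_numE.
Qed.

HB.instance Definition _ :=
  Measure_isSigmaFinite.Build _ _ _ (cons_measure m1 m2)
    cons_measure_sigma_finite.

End cons_measure_instances.

Fixpoint tuple_measure n :
    ('I_n -> {sigma_finite_measure set T -> \bar R}) ->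
    {sigma_finite_measure set n.-tuple T -> \bar R} :=
  match n with
  | 0 => fun=> @dirac _ (0.-tuple T) [tuple] R
  | n'.+1 => fun mu =>
      cons_measure (mu ord0) (tuple_measure (fun i => mu (lift ord0 i)))
  end.

End tuple_measure.

Section gaussian_sequence_model.
Context {R : realType}.

Definition Rvec n := n.-tuple (measurableTypeR R).

Definition lebesgue_vec n : {sigma_finite_measure set (Rvec n) -> \bar R} :=
  tuple_measure (fun _ : 'I_n => @lebesgue_measure R).

(* The library's normal_pdf and normal_prob take the standard deviation;
   below, v and the entries of s are variances. *)
Definition gauss_pdf n (theta : Rvec n) (v : R) (x : Rvec n) : R :=
  \prod_(i < n) normal_pdf (tnth theta i) (Num.sqrt v) (tnth x i).

Definition gauss_law n (theta : Rvec n) (v : R) :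
    {sigma_finite_measure set (Rvec n) -> \bar R} :=
  tuple_measure (fun i : 'I_n => normal_prob (tnth theta i) (Num.sqrt v)).

Definition centered_normal (s : R) :
    {sigma_finite_measure set (measurableTypeR R) -> \bar R} :=
  if s == 0
  then [the {sigma_finite_measure set _ -> \bar R} of
        @dirac _ (measurableTypeR R) 0 R]
  else [the {sigma_finite_measure set _ -> \bar R} of
        normal_prob 0 (Num.sqrt s)].

Definition gauss_prior n (s : Rvec n) :
    {sigma_finite_measure set (Rvec n) -> \bar R} :=
  tuple_measure (fun i : 'I_n => centered_normal (tnth s i)).

Definition noise_var (k : nat) : R := k%:R^-1.

(* phat x y stands for the predictive density of y given the observation x. *)
Definition predictive_density n (phat : Rvec n -> Rvec n -> R) : Prop :=
  [/\ measurable_fun setT (fun z : Rvec n * Rvec n => phat z.1 z.2),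
      forall x y, 0 <= phat x y
    & forall x, (\int[lebesgue_vec n]_y (phat x y)%:E = 1)%E].

(* The expectation is taken under the joint law of the independent pair (X, Y).
   Extended-real division and logarithm are used so that the log-ratio is +oo
   wherever phat vanishes. *)
Definition kl_risk n m (theta : Rvec n) (phat : Rvec n -> Rvec n -> R) :
    \bar R :=
  ((m%:R^-1)%:E *
   \int[gauss_law theta (noise_var n) \x gauss_law theta (noise_var m)]_z
     lne ((gauss_pdf theta (noise_var m) z.2)%:E / (phat z.1 z.2)%:E))%E.

Definition linear_density n m (s : Rvec n) (x y : Rvec n) : R :=
  (\int[gauss_prior s]_theta
     (gauss_pdf theta (noise_var n) x * gauss_pdf theta (noise_var m) y)) /
  (\int[gauss_prior s]_theta gauss_pdf theta (noise_var n) x).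

(* Sequences indexed from 1 in the mathematics are indexed from 0 here:
   a i is the (i+1)-st weight. *)
Definition ellipsoid (a : nat -> R) (C : R) n : set (Rvec n) :=
  [set theta | \sum_(i < n) a i ^+ 2 * (tnth theta i : R) ^+ 2 <= C].

Definition minimax_risk (a : nat -> R) (C : R) (n m : nat) : \bar R :=
  ereal_inf [set ereal_sup [set kl_risk m theta phat
                           | theta in @ellipsoid a C n]
            | phat in @predictive_density n].

Definition linear_minimax_risk (a : nat -> R) (C : R) (n m : nat) : \bar R :=
  ereal_inf [set ereal_sup [set kl_risk m theta (linear_density m s)
                           | theta in @ellipsoid a C n]
            | s in [set s : Rvec n | forall i, 0 <= (tnth s i : R)]].

Definition bracket (a : nat -> R) n m (lam : R) (i : nat) : R :=
  let w := noise_var n - noise_var (n + m) in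
  Num.max (w * Num.sqrt (1 + (4 * lam / a i ^+ 2) / w) - (noise_var n + noise_var (n + m)))
          0.

Definition theta_sq (a : nat -> R) n m (lam : R) (i : nat) : R :=
  2^-1 * bracket a n m lam i.

End gaussian_sequence_model.

(* Main.v *)
Require Import Defs.
From HB Require Import structures.
From mathcomp Require Import all_boot all_order all_algebra.
From mathcomp Require Import all_classical all_reals all_analysis.
From mathcomp Require Import measurable_realfun.
From mathcomp Require Import ring lra.

Set Implicit Arguments.
Unset Strict Implicit.
Unset Printing Implicit Defensive.

Import Order.TTheory GRing.Theory Num.Theory.
Import numFieldNormedType.Exports.

Local Open Scope classical_set_scope.
Local Open Scope ring_scope.

(* For a Gaussian prior with independent coordinates of variances s_i the Bayes
   predictive density is linear, its risk is affine in the theta_i^2 and its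
   Bayes risk is sum_i F(s_i) with F concave, F(0) = 0.  The variances
   t_i = theta_sq i satisfy the Karush-Kuhn-Tucker conditions for maximizing
   sum_i F under sum_i a_i^2 t_i <= C, so by linearity the predictive density of
   N(0, diag t) has risk at most V = sum_i F(t_i) over the ellipsoid; hence the
   minimax and the linear minimax risks are both at most V (up to the factor 1/m).
     For the lower bound take the prior N(0, diag((1 - e) t)), with Bayes density
   p_e, and any predictive density q.  From ln (p/q) >= ln (p/p_e) + 1 - q/p_e the
   risk of q at theta is at least that of p_e plus 1 - E_theta[q/p_e], and the
   prior mean of E_theta[q/p_e] is 1.  This is used on the ellipsoid only.  Off the
   ellipsoid, where T = sum_i a_i^2 theta_i^2 > C while E T = (1 - e) C, the risk of
   p_e is affine in T with slope O(V/C), because the multiplier times C is at most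
   V; so it is dominated by (5V + 1) (T - E T)^2 / (e C)^2.  Chebyshev's variance bound
   Var T = O(sum_i a_i^4 t_i^2) -> 0 then gives a minimax risk >= (1 - e - o(1)) V,
   V being bounded away from 0. *)

(** * Integration over tuples *)

Section tuple_measure_integration.
Context d (T : measurableType d) (R : realType).
Local Open Scope ereal_scope.

Lemma ge0_integral_cons_measure n
    (m1 : {sigma_finite_measure set T -> \bar R})
    (m2 : {sigma_finite_measure set n.-tuple T -> \bar R})
    (f : n.+1.-tuple T -> \bar R) :
  measurable_fun setT f -> (forall t, 0 <= f t) ->
  \int[cons_measure m1 m2]_t f t =
  \int[m1]_x \int[m2]_t f [the n.+1.-tuple T of x :: t].
Proof.
move=> mf f0.
rewrite [LHS]ge0_integral_pushforward//; last exact: measurable_cons_pair.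
rewrite preimage_setT fubini_tonelli1//.
  by apply: measurableT_comp => //; exact: measurable_cons_pair.
by move=> x /=; exact: f0.
Qed.

Lemma measurable_prod_tnth (n : nat) (f : 'I_n -> T -> R) :
  (forall i, measurable_fun setT (f i)) ->
  measurable_fun setT (fun t : n.-tuple T => \prod_(i < n) f i (tnth t i))%R.
Proof.
move=> mf; apply: measurable_prod => i _.
by apply: measurableT_comp => //; exact: measurable_tnth.
Qed.

(** Tonelli, one coordinate at a time: for a fixed head the inner integral is a constant factor.
    Real values [c i] avoid any product of 0 and infinity. *)
Lemma ge0_integral_tuple_prod n
    (mu : 'I_n -> {sigma_finite_measure set T -> \bar R})
    (f : 'I_n -> T -> R) (c : 'I_n -> R) :
  (forall i, measurable_fun setT (f i)) -> (forall i x, 0 <= f i x)%R ->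
  (forall i, \int[mu i]_x (f i x)%:E = (c i)%:E) ->
  \int[tuple_measure mu]_t (\prod_(i < n) f i (tnth t i))%:E =
  (\prod_(i < n) c i)%:E.
Proof.
elim: n mu f c => [|n ih] mu f c mf f0 fc.
  rewrite /= integral_dirac//.
    by rewrite diracT mul1e !big_ord0.
  by apply/measurable_EFinP; exact: measurable_prod_tnth.
rewrite /= ge0_integral_cons_measure; last 2 first.
- by apply/measurable_EFinP; exact: measurable_prod_tnth.
- by move=> t; rewrite lee_fin prodr_ge0.
transitivity (\int[mu ord0]_x ((f ord0 x)%:E *
    (\prod_(i < n) c (lift ord0 i))%:E)).
  apply: eq_integral => x _.
  rewrite -(ih (fun i => mu (lift ord0 i)) (fun i => f (lift ord0 i)))//.
  rewrite -ge0_integralZl//; last 3 first.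
  - apply/measurable_EFinP.
    exact: (@measurable_prod_tnth _ (fun i => f (lift ord0 i))).
  - by move=> t _; rewrite lee_fin prodr_ge0.
  - by rewrite lee_fin.
  apply: eq_integral => t _; rewrite big_ord_recl -EFinM; congr (_ * _)%:E%R.
  by apply: eq_bigr => i _; rewrite tnthS.
rewrite ge0_integralZr//; last 3 first.
- exact/measurable_EFinP.
- by move=> x _; rewrite lee_fin.
- rewrite lee_fin prodr_ge0// => i _.
  by rewrite -lee_fin -fc integral_ge0// => x _; rewrite lee_fin.
by rewrite fc -EFinM big_ord_recl.
Qed.

(** This is what turns a product of normal laws into Lebesgue measure weighted by [gauss_pdf]. The
    densities enter through their action on nonnegative functions, the form that the induction with
    Tonelli consumes. *)
Lemma ge0_integral_tuple_density n
    (mu nu : 'I_n -> {sigma_finite_measure set T -> \bar R})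
    (p : 'I_n -> T -> R) :
  (forall i, measurable_fun setT (p i)) -> (forall i x, 0 <= p i x)%R ->
  (forall i (f : T -> \bar R), measurable_fun setT f -> (forall x, 0 <= f x) ->
    \int[mu i]_x f x = \int[nu i]_x ((p i x)%:E * f x)) ->
  forall f : n.-tuple T -> \bar R,
    measurable_fun setT f -> (forall x, 0 <= f x) ->
  \int[tuple_measure mu]_t f t =
  \int[tuple_measure nu]_t ((\prod_(i < n) p i (tnth t i))%:E * f t).
Proof.
elim: n mu nu p => [|n ih] mu nu p mp p0 munu f mf f0.
  by rewrite /=; apply: eq_integral => t _; rewrite big_ord0 mul1e.
rewrite /= ge0_integral_cons_measure// ge0_integral_cons_measure; last 2 first.
- apply: emeasurable_funM => //; apply/measurable_EFinP.
  exact: measurable_prod_tnth.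
- by move=> t; rewrite mule_ge0// lee_fin prodr_ge0.
have mf2 : measurable_fun setT
    (fun z : T * n.-tuple T => f [the n.+1.-tuple T of z.1 :: z.2]).
  by apply: measurableT_comp => //; exact: measurable_cons_pair.
rewrite munu; last 2 first.
- exact: (@measurable_fun_fubini_tonelli_F _ _ _ _ _ (tuple_measure _)
    (fun z : T * n.-tuple T => f [the n.+1.-tuple T of z.1 :: z.2])).
- by move=> x; exact: integral_ge0.
apply: eq_integral => x _.
have mfx : measurable_fun setT
    (fun t : n.-tuple T => f [the n.+1.-tuple T of x :: t]).
  by apply: measurableT_comp => //; exact: measurable_cons.
rewrite (ih _ (fun i => nu (lift ord0 i)) (fun i => p (lift ord0 i)))//.
rewrite -ge0_integralZl//; last 3 first.
- apply: emeasurable_funM => //; apply/measurable_EFinP.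
  exact: (@measurable_prod_tnth _ (fun i => p (lift ord0 i))).
- by move=> t _; rewrite mule_ge0// lee_fin prodr_ge0.
- by rewrite lee_fin.
apply: eq_integral => t _; rewrite muleA -EFinM big_ord_recl.
  by congr ((_ * _)%:E * _); apply: eq_bigr => i _; rewrite tnthS.
by move=> i g mg g0; exact: munu.
Qed.

Lemma integral_cst1 d' (U : measurableType d') (m : {measure set U -> \bar R}) :
  m setT = 1 -> \int[m]_x (cst 1%R x)%:E = 1%:E.
Proof. by move=> m1; rewrite (integral_cst m measurableT 1) m1 mule1. Qed.

Lemma ge0_integral_tuple_tnth n
    (mu : 'I_n -> {sigma_finite_measure set T -> \bar R})
    (i : 'I_n) (f : T -> R) (c : R) :
  (forall j, mu j setT = 1) ->
  measurable_fun setT f -> (forall x, 0 <= f x)%R ->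
  \int[mu i]_x (f x)%:E = c%:E ->
  \int[tuple_measure mu]_t (f (tnth t i))%:E = c%:E.
Proof.
move=> mu1 mf f0 fc.
pose g j := if j == i then f else cst 1%R.
have := @ge0_integral_tuple_prod n mu g (fun j => if j == i then c else 1%R).
rewrite (bigD1 i)//= eqxx big1 ?mulr1; last by move=> j /negbTE ->.
move=> <-; first 1 last.
- by move=> j; rewrite /g; case: ifP.
- by move=> j x; rewrite /g; case: ifP.
- move=> j; rewrite /g; case: ifPn => [/eqP->//|_].
  exact: (integral_cst1 (mu1 _)).
apply: eq_integral => t _; rewrite (bigD1 i)//= /g eqxx big1 ?mulr1//.
by move=> j /negbTE ->.
Qed.

Lemma ge0_integral_tuple_tnth2 n
    (mu : 'I_n -> {sigma_finite_measure set T -> \bar R})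
    (i k : 'I_n) (f g : T -> R) (c e : R) :
  (forall j, mu j setT = 1) -> i != k ->
  measurable_fun setT f -> (forall x, 0 <= f x)%R ->
  measurable_fun setT g -> (forall x, 0 <= g x)%R ->
  \int[mu i]_x (f x)%:E = c%:E -> \int[mu k]_x (g x)%:E = e%:E ->
  \int[tuple_measure mu]_t (f (tnth t i) * g (tnth t k))%:E = (c * e)%:E.
Proof.
move=> mu1 ik mf f0 mg g0 fc ge.
pose h j := if j == i then f else if j == k then g else cst 1%R.
have := @ge0_integral_tuple_prod n mu h
  (fun j => if j == i then c else if j == k then e else 1%R).
have ki : (k == i) = false by rewrite eq_sym (negbTE ik).
rewrite (bigD1 i)//= (bigD1 k)//=; last by rewrite eq_sym.
rewrite !eqxx ki big1 ?mulr1; last by move=> j /andP[/negbTE-> /negbTE->].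
move=> <-; first 1 last.
- by move=> j; rewrite /h; case: ifP => // _; case: ifP.
- by move=> j x; rewrite /h; case: ifP => // _; case: ifP.
- move=> j; rewrite /h; case: ifPn => [/eqP->//|_]; case: ifPn => [/eqP->//|_].
  exact: (integral_cst1 (mu1 _)).
apply: eq_integral => t _; rewrite (bigD1 i)//= (bigD1 k)//=; last by rewrite eq_sym.
rewrite /h !eqxx ki big1 ?mulr1//.
by move=> j /andP[/negbTE-> /negbTE->].
Qed.

Lemma tuple_measure_setT n
    (mu : 'I_n -> {sigma_finite_measure set T -> \bar R}) :
  (forall j, mu j setT = 1) -> tuple_measure mu setT = 1.
Proof.
move=> mu1.
have := @ge0_integral_tuple_prod n mu (fun=> cst 1%R) (fun=> 1%R).
rewrite big1// => <-//; last by move=> i; exact: (integral_cst1 (mu1 _)).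
by rewrite -[LHS]mul1e -(integral_cst _ measurableT).
Qed.

End tuple_measure_integration.

(** * One-dimensional Gaussian integrals *)

Section gaussian_integrals.
Context {R : realType}.
Implicit Types m s c : R.
Notation leb := (@lebesgue_measure R).

(** By uniqueness it suffices to test half-open intervals; reflection swaps the closed end but keeps
    the length. *)
Lemma lebesgue_measure_reflect c (A : set R) : measurable A ->
  pushforward leb (fun x : measurableTypeR R => c - x : measurableTypeR R) A =
  leb A.
Proof.
move=> mA; apply/esym.
have mf : measurable_fun [set: measurableTypeR R]
  (fun x : measurableTypeR R => c - x : measurableTypeR R).
  exact: measurable_funB.
apply: lebesgue_measure_unique => //= _ [[a b]] _ <-.
rewrite /pushforward.
rewrite (_ : _ @^-1` _ = `[c - b, c - a[%classic).
  rewrite !lebesgue_measure_itv/= !lte_fin ltrD2l ltrN2 -!EFinD.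
  by case: ifP => // _; congr (_%:E); ring.
apply/seteqP; split => x /=; rewrite !in_itv/= => /andP[h1 h2]; apply/andP; split; lra.
Qed.

Lemma ge0_integral_reflect c (f : R -> \bar R) :
  measurable_fun setT f -> (forall x, 0 <= f x)%E ->
  (\int[leb]_x f x = \int[leb]_x f (c - x)%R)%E.
Proof.
move=> mf f0.
have mr : measurable_fun [set: measurableTypeR R]
  (fun x : measurableTypeR R => c - x : measurableTypeR R).
  exact: measurable_funB.
rewrite -[RHS](ge0_integral_pushforward mr leb measurableT mf); last first.
  by move=> x _; exact: f0.
apply: eq_measure_integral => A mA _.
exact/esym/lebesgue_measure_reflect.
Qed.

(** The Radon-Nikodym derivative and [normal_pdf] have the same integral over every measurable set,
    hence agree almost everywhere. *)
Lemma ge0_integral_normal_prob m s (f : R -> \bar R) :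
  measurable_fun setT f -> (forall x, 0 <= f x)%E ->
  (\int[normal_prob m s]_x f x =
   \int[leb]_x ((normal_pdf m s x)%:E * f x))%E.
Proof.
move=> mf f0.
rewrite -(Radon_Nikodym_SigmaFinite.change_of_variables
  (normal_prob_dominates m s))//.
have mp : measurable_fun setT (fun x => (normal_pdf m s x)%:E : \bar R).
  by apply/measurable_EFinP; exact: measurable_normal_pdf.
have iRN := Radon_Nikodym_SigmaFinite.f_integrable (normal_prob_dominates m s).
have mRN := measurable_int leb iRN.
under [RHS]eq_integral do rewrite muleC.
apply: ae_eq_integral => //; [exact: emeasurable_funM..|].
apply: ae_eqe_mul2l.
apply: integral_ae_eq => //= A _ mA.
by rewrite -Radon_Nikodym_SigmaFinite.f_integral//; exact: normal_prob_dominates.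
Qed.

Lemma normal_pdf_expE m s x : s != 0 ->
  normal_pdf m s x =
  (Num.sqrt (s ^+ 2 * pi *+ 2))^-1 * expR (- (x - m) ^+ 2 / (s ^+ 2 *+ 2)).
Proof. by move=> s0; rewrite normal_pdfE. Qed.

(** Tilting by a quadratic exponential only rescales the standard deviation. The resulting
    exponential moments of [(x - m) ^+ 2] yield the second and fourth moments below. *)
Lemma normal_pdf_tilt m s q x : 0 < s -> 0 < q ->
  expR ((1 - q ^+ 2) * (x - m) ^+ 2 / (s ^+ 2 *+ 2)) * normal_pdf m s x =
  q^-1 * normal_pdf m (s / q) x.
Proof.
move=> s0 q0.
rewrite !normal_pdf_expE ?gt_eqF ?divr_gt0// mulrCA -expRD.
rewrite [RHS]mulrA; congr (_ * expR _).
  have -> : (s / q) ^+ 2 * pi *+ 2 = q^-1 ^+ 2 * (s ^+ 2 * pi *+ 2).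
    by rewrite exprMn; ring.
  rewrite sqrtrM ?sqr_ge0// sqrtr_sqr gtr0_norm ?invr_gt0// invfM invrK mulKf//.
  by rewrite gt_eqF.
by field; rewrite !gt_eqF.
Qed.

Lemma integral_normal_tilt m s q : 0 < s -> 0 < q ->
  (\int[normal_prob m s]_x
    (expR ((1 - q ^+ 2) * (x - m) ^+ 2 / (s ^+ 2 *+ 2)))%:E = q^-1%:E)%E.
Proof.
move=> s0 q0.
have mt : measurable_fun setT
    (fun x : R => expR ((1 - q ^+ 2) * (x - m) ^+ 2 / (s ^+ 2 *+ 2))).
  apply: measurableT_comp => //; apply: measurable_funM => //.
  by apply: measurable_funM => //; apply: measurable_funX; exact: measurable_funB.
rewrite ge0_integral_normal_prob; last 2 first.
- exact/measurable_EFinP.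
- by move=> x; rewrite lee_fin expR_ge0.
under eq_integral do rewrite -EFinM mulrC normal_pdf_tilt// EFinM.
rewrite ge0_integralZl//; first by rewrite integral_normal_pdf mule1.
- by apply/measurable_EFinP; exact: measurable_normal_pdf.
- by move=> x _; rewrite lee_fin normal_pdf_ge0.
- by rewrite lee_fin invr_ge0 ltW.
Qed.

(* [q] is the free parameter of the tilting identity: letting [q -> 1] from
   both sides pins down the second moment. *)
Lemma integral_normal_sqr m s : 0 < s ->
  (\int[normal_prob m s]_x ((x - m) ^+ 2)%:E = (s ^+ 2)%:E)%E.
Proof.
move=> s0.
pose u (x : R) := (x - m) ^+ 2 / (s ^+ 2 *+ 2).
have s20 : 0 < s ^+ 2 *+ 2 by rewrite mulrn_wgt0// exprn_gt0.
have u0 x : 0 <= u x by rewrite divr_ge0 ?sqr_ge0// ltW.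
have mu : measurable_fun setT u.
  by apply: measurable_funM => //; apply: measurable_funX; exact: measurable_funB.
have tilt q : 0 < q ->
    (\int[normal_prob m s]_x (expR ((1 - q ^+ 2) * u x))%:E = q^-1%:E)%E.
  move=> q0; rewrite -(integral_normal_tilt m s0 q0).
  by apply: eq_integral => x _; rewrite mulrA.
have mt q : measurable_fun setT (fun x => expR ((1 - q ^+ 2) * u x)).
  by apply: measurableT_comp => //; exact: measurable_funM.
have one : (\int[normal_prob m s]_x 1%:E = 1%:E)%E.
  exact: (integral_cst1 (probability_setT (normal_prob m s))).
pose U := (\int[normal_prob m s]_x (u x)%:E)%E.
have U0 : (0 <= U)%E by apply: integral_ge0 => x _; rewrite lee_fin.
have kU k : 0 <= k -> (\int[normal_prob m s]_x (k * u x)%:E = k%:E * U)%E.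
  move=> k0; under eq_integral do rewrite EFinM.
  rewrite ge0_integralZl//; first exact/measurable_EFinP.
  by move=> x _; rewrite lee_fin.
have ub q : 0 < q -> q < 1 -> (1 + (1 - q ^+ 2)%:E * U <= q^-1%:E)%E.
  move=> q0 q1; have k0 : 0 <= 1 - q ^+ 2 by rewrite subr_ge0 expr_le1// ltW.
  rewrite -tilt// -kU// -one -ge0_integralD//; last 2 first.
  - by move=> x _; rewrite lee_fin mulr_ge0.
  - by apply/measurable_EFinP; exact: measurable_funM.
  apply: ge0_le_integral => //.
  - by move=> x _; rewrite -EFinD lee_fin addr_ge0// mulr_ge0.
  - by apply/measurable_EFinP; apply: measurable_funD => //; exact: measurable_funM.
  - by apply/measurable_EFinP; exact: mt.
  - by move=> x _; rewrite -EFinD lee_fin expR_ge1Dx.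
have lb q : 1 < q -> (1 <= q^-1%:E + (q ^+ 2 - 1)%:E * U)%E.
  move=> q1; have q0 : 0 < q by lra.
  have k0 : 0 <= q ^+ 2 - 1 by rewrite subr_ge0 expr_ge1// ltW.
  rewrite -tilt// -kU// -[leLHS]one -ge0_integralD//; last 3 first.
  - by apply/measurable_EFinP; exact: mt.
  - by move=> x _; rewrite lee_fin mulr_ge0.
  - by apply/measurable_EFinP; exact: measurable_funM.
  apply: ge0_le_integral => //.
  - by apply: emeasurable_funD; apply/measurable_EFinP; [exact: mt|exact: measurable_funM].
  - move=> x _; rewrite -EFinD lee_fin.
    by have := expR_ge1Dx ((1 - q ^+ 2) * u x); lra.
(* At [q = 1/2] the upper estimate bounds a positive multiple of [U] by a finite number. *)
have Ufin : U \is a fin_num.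
  rewrite ge0_fin_numE// ltey; apply/eqP => Uy.
  have := ub 2^-1; rewrite Uy gt0_muley; last by rewrite lte_fin; lra.
  by rewrite addey// leye_eq => /(_ _ _)/eqP h; discriminate h; lra.
have UE : fine U = 2^-1.
  have fU0 : 0 <= fine U by exact: fine_ge0.
  apply/eqP; rewrite eq_le !leNgt; apply/andP; split; apply/negP => Ulh.
  - have U1 : 0 < fine U by lra.
    (* With [q = 1 - e] the upper estimate says [(1 - e) * (2 - e) * U <= 1]. This [e] makes
       [(2 - 3 * e) * U = U + 1/2 > 1], a contradiction. *)
    pose e := (2 * fine U - 1) / (6 * fine U).
    have eE : e * (6 * fine U) = 2 * fine U - 1 by rewrite /e divfK// gt_eqF// mulr_gt0.
    have e0 : 0 < e by rewrite divr_gt0// ?mulr_gt0//; lra.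
    have e1 : e < 3^-1 by nra.
    have q0 : 0 < 1 - e by lra.
    have := ub (1 - e) q0; rewrite -[U]fineK// -EFinM -EFinD lee_fin => /(_ _).
    rewrite -(@ler_pM2r _ (1 - e))// mulVf ?gt_eqF// => h.
    have {h} : (1 + (1 - (1 - e) ^+ 2) * fine U) * (1 - e) <= 1 by apply: h; lra.
    have : (1 - e) * (2 - e) * fine U > 1 by nra.
    by nra.
  (* With [q = 1 + e] the lower estimate says [1 <= (1 + e) * (2 + e) * U], which fails for this
     [e]. *)
  - pose e := (1 - 2 * fine U) / 4.
    have e0 : 0 < e by rewrite /e; lra.
    have := lb (1 + e); rewrite -[U]fineK// -EFinM -EFinD lee_fin => /(_ _).
    have q0 : 0 < 1 + e by lra.
    rewrite -(@ler_pM2r _ (1 + e))// mulrDl mulVf ?gt_eqF// => h.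
    have {h} : 1 * (1 + e) <= 1 + ((1 + e) ^+ 2 - 1) * fine U * (1 + e) by apply: h; lra.
    have : (1 + e) * (2 + e) * fine U < 1 by rewrite /e; nra.
    by nra.
transitivity (\int[normal_prob m s]_x ((s ^+ 2 *+ 2) * u x)%:E)%E.
  apply: eq_integral => x _; congr EFin; rewrite /u mulrC divfK//.
  by rewrite gt_eqF.
rewrite kU ?ltW// -[U]fineK// UE -EFinM; congr EFin.
by field.
Qed.

End gaussian_integrals.

(** * Gaussian moments, conjugacy and convolution *)

Section gaussian_moments.
Context {R : realType}.
Implicit Types m s c : R.
Notation leb := (@lebesgue_measure R).

Lemma ge0_integral_normal_reflect m s (f : R -> \bar R) : s != 0 ->
  measurable_fun setT f -> (forall x, 0 <= f x)%E ->
  (\int[normal_prob m s]_x f x = \int[normal_prob m s]_x f (2 * m - x)%R)%E.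
Proof.
move=> s0 mf f0.
have mp : measurable_fun setT (fun x => (normal_pdf m s x)%:E : \bar R).
  by apply/measurable_EFinP; exact: measurable_normal_pdf.
have mr : measurable_fun setT (fun x : R => f (2 * m - x)).
  by apply: measurableT_comp => //; exact: measurable_funB.
rewrite ge0_integral_normal_prob// ge0_integral_normal_prob//.
rewrite (ge0_integral_reflect (2 * m)).
- apply: eq_integral => x _; congr (_%:E * _)%E; rewrite !normal_pdf_expE //.
  by congr (_ * expR _); congr (- _ / _); ring.
- exact: emeasurable_funM.
- by move=> x; rewrite mule_ge0// lee_fin normal_pdf_ge0.
Qed.

(** Adding the integral to its reflection about [m] cancels the cross term, so only nonnegative
    integrands occur. *)
Lemma integral_normal_affine_sqr m s alpha beta : 0 < s ->
  (\int[normal_prob m s]_x ((alpha + beta * x) ^+ 2)%:E =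
   ((alpha + beta * m) ^+ 2 + beta ^+ 2 * s ^+ 2)%:E)%E.
Proof.
move=> s0; set I := LHS.
have ma b : measurable_fun setT (fun x : R => (alpha + beta * (b + x)) ^+ 2).
  apply: measurable_funX; apply: measurable_funD => //.
  by apply: measurable_funM => //; exact: measurable_funD.
have mz : measurable_fun setT (fun x : R => (x - m) ^+ 2).
  by apply: measurable_funX; exact: measurable_funB.
have mf : measurable_fun setT (fun x : R => (alpha + beta * x) ^+ 2).
  by apply: measurable_funX; apply: measurable_funD => //; exact: measurable_funM.
have mr : measurable_fun setT (fun x : R => (alpha + beta * (2 * m - x)) ^+ 2).
  apply: measurable_funX; apply: measurable_funD => //; apply: measurable_funM => //.
  exact: measurable_funB.
have I0 : (0 <= I)%E by apply: integral_ge0 => x _; rewrite lee_fin sqr_ge0.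
have II : (I + I = ((alpha + beta * m) ^+ 2 + beta ^+ 2 * s ^+ 2)%:E +
                  ((alpha + beta * m) ^+ 2 + beta ^+ 2 * s ^+ 2)%:E)%E.
  rewrite {2}/I ge0_integral_normal_reflect ?gt_eqF//; last 2 first.
  - exact/measurable_EFinP.
  - by move=> x; rewrite lee_fin sqr_ge0.
  rewrite -ge0_integralD//; last 4 first.
  - by move=> x _; rewrite lee_fin sqr_ge0.
  - exact/measurable_EFinP.
  - by move=> x _; rewrite lee_fin sqr_ge0.
  - exact/measurable_EFinP.
  transitivity (\int[normal_prob m s]_x
     ((2 * (alpha + beta * m) ^+ 2)%:E * (cst 1%R x)%:E +
      (2 * beta ^+ 2)%:E * ((x - m) ^+ 2)%:E))%E.
    by apply: eq_integral => x _; rewrite -!EFinM -!EFinD/=; congr EFin; ring.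
  have h1 : 0 <= 2 * (alpha + beta * m) ^+ 2 by rewrite mulr_ge0// sqr_ge0.
  have h2 : 0 <= 2 * beta ^+ 2 by rewrite mulr_ge0// sqr_ge0.
  rewrite ge0_integralD//; last 4 first.
  - by move=> x _; rewrite -EFinM lee_fin mulr1.
  - by apply/measurable_EFinP; exact: measurable_funM.
  - by move=> x _; rewrite -EFinM lee_fin mulr_ge0// sqr_ge0.
  - by apply/measurable_EFinP; exact: measurable_funM.
  rewrite ge0_integralZl//; last exact/measurable_EFinP.
  rewrite ge0_integralZl//; last 2 first.
  - exact/measurable_EFinP.
  - by move=> x _; rewrite lee_fin sqr_ge0.
  rewrite integral_normal_sqr// (integral_cst1 (probability_setT (normal_prob m s))).
  by rewrite -!EFinM -!EFinD; congr EFin; ring.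
move: II; case: I I0 => // r _ [] rr; congr EFin; lra.
Qed.

(** Let [y] be the tilting exponent at [q = 1/2]. Then [(x - m) ^+ 4 = (64/9) * s ^+ 4 * y ^+ 2],
    which [y ^+ 2 / 2 <= expR y] bounds by [16 * s ^+ 4 * expR y]; the exponential integrates to 2.
    A crude constant is enough for Chebyshev's bound. *)
Lemma integral_normal_pow4_le m s : 0 < s ->
  (\int[normal_prob m s]_x ((x - m) ^+ 4)%:E <= (32 * s ^+ 4)%:E)%E.
Proof.
move=> s0.
have h0 : 0 < (2^-1 : R) by lra.
have c0 : 0 <= 16 * s ^+ 4 by rewrite mulr_ge0// exprn_ge0// ltW.
pose g (x : R) := expR ((1 - 2^-1 ^+ 2) * (x - m) ^+ 2 / (s ^+ 2 *+ 2)).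
have mg : measurable_fun setT g.
  apply: measurableT_comp => //; apply: measurable_funM => //.
  by apply: measurable_funM => //; apply: measurable_funX; exact: measurable_funB.
apply: (@le_trans _ _ (\int[normal_prob m s]_x ((16 * s ^+ 4)%:E * (g x)%:E))%E).
  apply: ge0_le_integral => //.
  - by move=> x _; rewrite lee_fin exprn_even_ge0.
  - by apply/measurable_EFinP; apply: measurable_funX; exact: measurable_funB.
  - by apply/measurable_EFinP; exact: measurable_funM.
  - move=> x _; rewrite -EFinM lee_fin /g.
    set y := (X in expR X).
    have y0 : 0 <= y.
      rewrite /y; apply: divr_ge0; last by rewrite mulrn_wge0// sqr_ge0.
      by rewrite mulr_ge0 ?sqr_ge0//; lra.
    have := expR_ge1Dxn 1 y0.
    have -> : (x - m) ^+ 4 = (64 / 9) * s ^+ 4 * y ^+ 2.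
      by rewrite /y; field; rewrite gt_eqF.
    have s4 : 0 <= s ^+ 4 by rewrite exprn_ge0// ltW.
    rewrite (_ : 2`!%:R = 2 :> R)// => h.
    have h2 : y ^+ 2 / 2 <= expR y by lra.
    have h3 : s ^+ 4 * (y ^+ 2 / 2) <= s ^+ 4 * expR y by rewrite ler_wpM2l.
    have h4 : 0 <= s ^+ 4 * expR y by rewrite mulr_ge0// expR_ge0.
    lra.
rewrite ge0_integralZl//; last 2 first.
- exact/measurable_EFinP.
- by move=> x _; rewrite lee_fin expR_ge0.
rewrite integral_normal_tilt// -EFinM lee_fin invrK.
by rewrite mulrAC -natrM.
Qed.

Local Notation gpdf v c x := (normal_pdf c (Num.sqrt v) x).

Lemma normal_pdf_var (v : R) c x : 0 < v ->
  gpdf v c x = (Num.sqrt (v * pi *+ 2))^-1 * expR (- (x - c) ^+ 2 / (v *+ 2)).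
Proof.
by move=> v0; rewrite normal_pdf_expE ?gt_eqF ?sqrtr_gt0// sqr_sqrtr// ltW.
Qed.

Lemma normal_pdf_var_gt0 (v : R) c x : 0 < v -> 0 < gpdf v c x.
Proof.
move=> v0; rewrite normal_pdf_var// mulr_gt0 ?expR_gt0// invr_gt0 sqrtr_gt0.
by rewrite mulrn_wgt0// mulr_gt0// pi_gt0.
Qed.

(** Completing the square: prior times likelihood equals marginal times posterior. *)
Lemma normal_pdf_conjugate (s v c x t : R) : 0 < s -> 0 < v ->
  gpdf s c t * gpdf v t x =
  gpdf (s + v) c x * gpdf (s * v / (s + v)) ((v * c + s * x) / (s + v)) t.
Proof.
move=> s0 v0; have sv0 : 0 < s + v by rewrite addr_gt0.
have w0 : 0 < s * v / (s + v) by rewrite divr_gt0// mulr_gt0.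
rewrite !normal_pdf_var// mulrACA [RHS]mulrACA -!expRD -!invfM; congr (_^-1 * expR _).
  have g u : 0 < u -> 0 <= u * pi *+ 2 :> R.
    by move=> u0; rewrite mulrn_wge0// mulr_ge0 ?pi_ge0// ltW.
  by rewrite -!sqrtrM ?g//; congr Num.sqrt; field; rewrite gt_eqF.
by field; rewrite !gt_eqF.
Qed.

Lemma measurable_normal_pdf2 d (U : measurableType d) (v : R) (f g : U -> R) :
  0 < v -> measurable_fun setT f -> measurable_fun setT g ->
  measurable_fun setT (fun z => gpdf v (f z) (g z)).
Proof.
move=> v0 mf mg; under eq_fun do rewrite normal_pdf_var//.
apply: measurable_funM => //; apply: measurableT_comp => //.
apply: measurable_funM => //; apply: measurableT_comp => //.
by apply: measurable_funX; exact: measurable_funB.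
Qed.

Lemma integral_normal_convolution (s v c x : R) : 0 < s -> 0 < v ->
  (\int[normal_prob c (Num.sqrt s)]_t (gpdf v t x)%:E = (gpdf (s + v) c x)%:E)%E.
Proof.
move=> s0 v0; have sv0 : 0 < s + v by rewrite addr_gt0.
have w0 : 0 < s * v / (s + v) by rewrite divr_gt0// mulr_gt0.
rewrite ge0_integral_normal_prob; last 2 first.
- by apply/measurable_EFinP; exact: measurable_normal_pdf2.
- by move=> t; rewrite lee_fin normal_pdf_ge0.
under eq_integral do rewrite -EFinM normal_pdf_conjugate// EFinM.
rewrite ge0_integralZl//; first by rewrite integral_normal_pdf mule1.
- by apply/measurable_EFinP; exact: measurable_normal_pdf.
- by move=> t _; rewrite lee_fin normal_pdf_ge0.
- by rewrite lee_fin normal_pdf_ge0.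
Qed.

Lemma integral_centered_normal_pdf (s v x : R) : 0 <= s -> 0 < v ->
  (\int[centered_normal s]_t (gpdf v t x)%:E = (gpdf (s + v) 0 x)%:E)%E.
Proof.
move=> s0 v0; rewrite /centered_normal; case: ifPn => [/eqP->|sn0].
  rewrite integral_dirac//; first by rewrite diracT mul1e add0r.
  by apply/measurable_EFinP; exact: measurable_normal_pdf2.
by rewrite integral_normal_convolution// lt_neqAle eq_sym sn0.
Qed.

(** Conjugacy pulls out the marginal of [x]; the posterior of [t] is then convolved with the noise
    of [y]. The right-hand side is written so that the point mass [s = 0] obeys the same formula. *)
Lemma integral_centered_normal_pdf2 (s v u x y : R) : 0 <= s -> 0 < v -> 0 < u ->
  (\int[centered_normal s]_t (gpdf v t x * gpdf u t y)%:E =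
   (gpdf (s + v) 0 x * gpdf (s / (s + v) * v + u) (s / (s + v) * x) y)%:E)%E.
Proof.
move=> s0 v0 u0; rewrite /centered_normal; case: ifPn => [/eqP->|sn0].
  rewrite integral_dirac//.
    by rewrite diracT mul1e !add0r !mul0r add0r.
  by apply/measurable_EFinP; apply: measurable_funM; exact: measurable_normal_pdf2.
have {sn0}s0 : 0 < s by rewrite lt_neqAle eq_sym sn0.
have sv0 : 0 < s + v by rewrite addr_gt0.
have w0 : 0 < s * v / (s + v) by rewrite divr_gt0// mulr_gt0.
rewrite ge0_integral_normal_prob; last 2 first.
- by apply/measurable_EFinP; apply: measurable_funM; exact: measurable_normal_pdf2.
- by move=> t; rewrite lee_fin mulr_ge0// normal_pdf_ge0.
under eq_integral do
  rewrite -EFinM mulrA normal_pdf_conjugate// -(mulrA (gpdf (s + v) 0 x)) EFinM.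
have m1 : measurable_fun setT (fun t : R => gpdf u t y).
  exact: measurable_normal_pdf2.
have m2 c w : measurable_fun setT (fun t : R => gpdf w c t).
  exact: measurable_normal_pdf.
rewrite ge0_integralZl//.
- under eq_integral do rewrite EFinM.
  rewrite -ge0_integral_normal_prob; last 2 first.
  + exact/measurable_EFinP.
  + by move=> t; rewrite lee_fin normal_pdf_ge0.
  rewrite integral_normal_convolution// -EFinM mulr0 add0r.
  by rewrite (mulrAC s v) (mulrAC s x).
- by apply/measurable_EFinP; exact: (measurable_funM (m2 _ _) m1).
- by move=> t _; rewrite lee_fin mulr_ge0 ?normal_pdf_ge0.
- by rewrite lee_fin normal_pdf_ge0.
Qed.

End gaussian_moments.

(** * The Gaussian sequence model *)

Section tonelli_product.
Context d d1 d2 (T : measurableType d) (T1 : measurableType d1)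
  (T2 : measurableType d2) (R : realType).
Variables (m : {sigma_finite_measure set T -> \bar R})
  (m1 : {sigma_finite_measure set T1 -> \bar R})
  (m2 : {sigma_finite_measure set T2 -> \bar R}) (f : T * (T1 * T2) -> \bar R).
Hypotheses (mf : measurable_fun setT f) (f0 : forall w, (0 <= f w)%E).

Let g (w : T * T1) : \bar R := (\int[m2]_y f (w.1, (w.2, y)))%E.

Let mg : measurable_fun setT g.
Proof.
pose g' (w : (T * T1) * T2) : \bar R := f (w.1.1, (w.1.2, w.2)).
have mg' : measurable_fun setT g'.
  apply: measurableT_comp => //; apply: measurable_fun_pair => /=.
    exact: measurableT_comp.
  by apply: measurable_fun_pair => //=; exact: measurableT_comp.
by apply: (@measurable_fun_fubini_tonelli_F _ _ _ _ _ m2 g') => // w; exact: f0.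
Qed.

Let g0 w : (0 <= g w)%E. Proof. exact: integral_ge0. Qed.

Let gE : (fun t => \int[m1 \x m2]_z f (t, z))%E = (fun t => \int[m1]_x g (t, x))%E.
Proof.
apply/funext => t; rewrite fubini_tonelli1//.
by apply: measurableT_comp => //; exact: measurable_fun_pair.
Qed.

Lemma measurable_integral_product :
  measurable_fun setT (fun t => \int[m1 \x m2]_z f (t, z))%E.
Proof. by rewrite gE; exact: (@measurable_fun_fubini_tonelli_F _ _ _ _ _ m1 g). Qed.

(** Once the integral over [m1 \x m2] is iterated, [m] moves past [m1] and then past [m2], by
    Tonelli on pairs each time. *)
Lemma ge0_integral_product_swap :
  (\int[m]_t \int[m1 \x m2]_z f (t, z) =
   \int[m1 \x m2]_z \int[m]_t f (t, z))%E.
Proof.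
pose k (z : T1 * T2) : \bar R := (\int[m]_t f (t, z))%E.
have mk : measurable_fun setT k.
  exact: (@measurable_fun_fubini_tonelli_G _ _ _ _ _ m f).
rewrite gE (@fubini_tonelli _ _ _ _ _ m m1 g mg g0).
transitivity (\int[m1 \x m2]_z k z)%E => //.
rewrite fubini_tonelli1//; last by move=> z; exact: integral_ge0.
apply: eq_integral => x _; rewrite /fubini_F /g /k/=.
rewrite (@fubini_tonelli _ _ _ _ _ m m2 (fun w => f (w.1, (x, w.2))))//.
apply: measurableT_comp => //; apply: measurable_fun_pair => //.
exact: measurable_fun_pair.
Qed.

End tonelli_product.

Section model_integrals.
Context {R : realType}.
Variable n : nat.
Implicit Types (theta s x y : @Rvec R n) (v u : R).
Local Notation gpdf v c x := (normal_pdf c (Num.sqrt v) x).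
Local Notation leb := (@lebesgue_vec R n).

Lemma gauss_pdf_gt0 theta v x : 0 < v -> 0 < gauss_pdf theta v x.
Proof. by move=> v0; apply: prodr_gt0 => i _; exact: normal_pdf_var_gt0. Qed.

Lemma measurable_coord d (U : measurableType d) (f : U -> @Rvec R n) i :
  measurable_fun setT f -> measurable_fun setT (fun z => tnth (f z) i : R).
Proof.
move=> mf; apply: (@measurableT_comp _ _ _ _ _ _ (fun t : @Rvec R n => tnth t i)) => //.
exact: measurable_tnth.
Qed.

Lemma measurable_gauss_pdf d (U : measurableType d) (f g : U -> @Rvec R n) v :
  0 < v -> measurable_fun setT f -> measurable_fun setT g ->
  measurable_fun setT (fun z => gauss_pdf (f z) v (g z)).
Proof.
move=> v0 mf mg; apply: measurable_prod => i _.
by apply: measurable_normal_pdf2 => //; exact: measurable_coord.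
Qed.

Lemma ge0_integral_gauss_law theta v (f : @Rvec R n -> \bar R) : 0 < v ->
  measurable_fun setT f -> (forall x, 0 <= f x)%E ->
  (\int[gauss_law theta v]_x f x =
   \int[leb]_x ((gauss_pdf theta v x)%:E * f x))%E.
Proof.
move=> v0 mf f0; rewrite /gauss_law /lebesgue_vec.
rewrite (@ge0_integral_tuple_density _ _ _ _ _ (fun=> lebesgue_measure)
  (fun i => normal_pdf (tnth theta i) (Num.sqrt v)))//.
- by move=> i; exact: measurable_normal_pdf.
- by move=> i x; exact: normal_pdf_ge0.
- by move=> i g mg g0; exact: ge0_integral_normal_prob.
Qed.

Lemma ge0_integral_gauss_law2 theta v u (f : @Rvec R n * @Rvec R n -> \bar R) :
  0 < v -> 0 < u -> measurable_fun setT f -> (forall z, 0 <= f z)%E ->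
  (\int[gauss_law theta v \x gauss_law theta u]_z f z =
   \int[leb \x leb]_z
     ((gauss_pdf theta v z.1 * gauss_pdf theta u z.2)%:E * f z))%E.
Proof.
move=> v0 u0 mf f0.
have mv : measurable_fun setT (fun z : @Rvec R n * @Rvec R n => gauss_pdf theta v z.1).
  exact: measurable_gauss_pdf.
have mu : measurable_fun setT (fun z : @Rvec R n * @Rvec R n => gauss_pdf theta u z.2).
  exact: measurable_gauss_pdf.
have muy : measurable_fun setT (fun y : @Rvec R n => gauss_pdf theta u y).
  exact: measurable_gauss_pdf.
rewrite fubini_tonelli1// fubini_tonelli1//; last 2 first.
- by apply: emeasurable_funM => //; apply/measurable_EFinP; exact: measurable_funM.
- by move=> z; rewrite mule_ge0// lee_fin mulr_ge0// ltW// gauss_pdf_gt0.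
rewrite /fubini_F /= ge0_integral_gauss_law//; last 2 first.
- exact: (@measurable_fun_fubini_tonelli_F _ _ _ _ _ (gauss_law theta u) f).
- by move=> x; exact: integral_ge0.
apply: eq_integral => x _.
have mfx : measurable_fun setT (fun y : @Rvec R n => f (x, y)).
  by apply: measurableT_comp => //; exact: measurable_fun_pair.
rewrite ge0_integral_gauss_law//.
rewrite -ge0_integralZl//; last 3 first.
- by apply: emeasurable_funM => //; exact/measurable_EFinP.
- by move=> y _; rewrite mule_ge0// lee_fin ltW// gauss_pdf_gt0.
- by rewrite lee_fin ltW// gauss_pdf_gt0.
by apply: eq_integral => y _; rewrite muleA EFinM.
Qed.

Lemma gauss_law_setT theta v : gauss_law theta v setT = 1%E.
Proof. by apply: tuple_measure_setT => i; exact: probability_setT. Qed.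

Lemma gauss_law2_setT theta v u : (gauss_law theta v \x gauss_law theta u)%E setT = 1%E.
Proof.
rewrite -setXTT product_measure1E; [|exact: measurableT..].
by rewrite -[RHS]mule1; congr (_ * _)%E; exact: gauss_law_setT.
Qed.

Lemma integral_gauss_law_affine_sqr theta v (i : 'I_n) alpha beta : 0 < v ->
  (\int[gauss_law theta v]_x ((alpha + beta * tnth x i) ^+ 2)%:E =
   ((alpha + beta * tnth theta i) ^+ 2 + beta ^+ 2 * v)%:E)%E.
Proof.
move=> v0.
apply: (@ge0_integral_tuple_tnth _ _ _ _ _ i
  (fun t : measurableTypeR R => (alpha + beta * t) ^+ 2)).
- by move=> j; exact: probability_setT.
- by apply: measurable_funX; apply: measurable_funD => //; exact: measurable_funM.
- by move=> t; exact: sqr_ge0.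
- by rewrite /= integral_normal_affine_sqr ?sqrtr_gt0// sqr_sqrtr// ltW.
Qed.

(** Integrating the second observation contributes [u], the first [beta ^+ 2 * v]. Both squares in
    the Gaussian log-ratio have this shape. *)
Lemma integral_gauss_law2_affine_sqr theta v u (i : 'I_n) alpha beta :
  0 < v -> 0 < u ->
  (\int[gauss_law theta v \x gauss_law theta u]_z
      ((alpha + tnth z.2 i - beta * tnth z.1 i) ^+ 2)%:E =
   ((alpha + (1 - beta) * tnth theta i) ^+ 2 + beta ^+ 2 * v + u)%:E)%E.
Proof.
move=> v0 u0.
rewrite fubini_tonelli1//; last 2 first.
- apply/measurable_EFinP; apply: measurable_funX; apply: measurable_funB.
    by apply: measurable_funD => //; exact: measurable_coord.
  by apply: measurable_funM => //; exact: measurable_coord.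
- by move=> z; rewrite lee_fin sqr_ge0.
transitivity (\int[gauss_law theta v]_x
  (((alpha + tnth theta i + (- beta) * tnth x i) ^+ 2)%:E + u%:E * (cst 1 x)%:E))%E.
  apply: eq_integral => x _; rewrite /fubini_F/=.
  transitivity (\int[gauss_law theta u]_y
     ((alpha - beta * tnth x i + 1 * tnth y i) ^+ 2)%:E)%E.
    by apply: eq_integral => y _; congr (_%:E); ring.
  by rewrite integral_gauss_law_affine_sqr// -EFinM -EFinD; congr EFin; ring.
have mx : measurable_fun setT (fun x : @Rvec R n => tnth x i : R).
  exact: measurable_coord.
rewrite ge0_integralD//; last 4 first.
- by move=> x _; rewrite lee_fin sqr_ge0.
- apply/measurable_EFinP; apply: measurable_funX.
  by apply: measurable_funD => //; exact: measurable_funM.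
- by move=> x _; rewrite -EFinM lee_fin mulr1 ltW.
- by apply/measurable_EFinP; exact: measurable_funM.
rewrite integral_gauss_law_affine_sqr// ge0_integralZl//; last 2 first.
- exact/measurable_EFinP.
- by rewrite lee_fin ltW.
rewrite (integral_cst1 (gauss_law_setT _ _)) -EFinM -EFinD; congr EFin; ring.
Qed.

End model_integrals.

(** * Closed form of the Bayes predictive density of a Gaussian prior *)

Section linear_predictive_density.
Context {R : realType}.
Variable n : nat.
Implicit Types (theta s x y : @Rvec R n) (v u : R).
Local Notation gpdf v c x := (normal_pdf c (Num.sqrt v) x).
Local Notation leb := (@lebesgue_vec R n).

(** For a coordinate with prior variance [t], the posterior mean is [shrink v t] times the
    observation and the posterior variance is [shrink v t * v]. *)
Definition shrink v (t : R) : R := t / (t + v).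

Definition predictive_var v u (t : R) : R := shrink v t * v + u.

(** Closed form of the quotient of integrals in [linear_density], as [bayes_predE] shows. *)
Definition bayes_pred s v u x y : R :=
  \prod_(i < n) gpdf (predictive_var v u (tnth s i))
                     (shrink v (tnth s i) * tnth x i) (tnth y i).

Definition marginal_pdf s v x : R :=
  \prod_(i < n) gpdf (tnth s i + v) 0 (tnth x i).

Lemma shrink_ge0 v (t : R) : 0 < v -> 0 <= t -> 0 <= shrink v t.
Proof. by move=> v0 t0; rewrite divr_ge0// addr_ge0// ltW. Qed.

Lemma predictive_var_gt0 v u (t : R) : 0 < v -> 0 < u -> 0 <= t ->
  0 < predictive_var v u t.
Proof. by move=> v0 u0 t0; rewrite ltr_wpDl// mulr_ge0 ?shrink_ge0// ltW. Qed.

Variables (s : @Rvec R n) (v u : R).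
Hypotheses (s0 : forall i, 0 <= (tnth s i : R)) (v0 : 0 < v) (u0 : 0 < u).

Lemma bayes_pred_gt0 x y : 0 < bayes_pred s v u x y.
Proof.
by apply: prodr_gt0 => i _; apply: normal_pdf_var_gt0; exact: predictive_var_gt0.
Qed.

Lemma marginal_pdf_gt0 x : 0 < marginal_pdf s v x.
Proof.
by apply: prodr_gt0 => i _; apply: normal_pdf_var_gt0; rewrite ltr_wpDl.
Qed.

Lemma measurable_bayes_pred :
  measurable_fun setT (fun z : @Rvec R n * @Rvec R n => bayes_pred s v u z.1 z.2).
Proof.
apply: measurable_prod => i _; apply: measurable_normal_pdf2.
- exact: predictive_var_gt0.
- by apply: measurable_funM => //; exact: measurable_coord.
- exact: measurable_coord.
Qed.

Lemma integral_gauss_prior_pdf x :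
  (\int[gauss_prior s]_t (gauss_pdf t v x)%:E = (marginal_pdf s v x)%:E)%E.
Proof.
apply: (@ge0_integral_tuple_prod _ _ _ _ _
  (fun i (t : measurableTypeR R) => gpdf v t (tnth x i))).
- by move=> i; exact: measurable_normal_pdf2.
- by move=> i t; exact: normal_pdf_ge0.
- by move=> i; exact: integral_centered_normal_pdf.
Qed.

Lemma integral_gauss_prior_pdf2 x y :
  (\int[gauss_prior s]_t (gauss_pdf t v x * gauss_pdf t u y)%:E =
   (marginal_pdf s v x * bayes_pred s v u x y)%:E)%E.
Proof.
rewrite /marginal_pdf /bayes_pred -big_split/=.
under eq_integral do rewrite /gauss_pdf -big_split/=.
apply: (@ge0_integral_tuple_prod _ _ _ _ _
  (fun i (t : measurableTypeR R) => gpdf v t (tnth x i) * gpdf u t (tnth y i))).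
- by move=> i; apply: measurable_funM; exact: measurable_normal_pdf2.
- by move=> i t; rewrite mulr_ge0// normal_pdf_ge0.
- by move=> i; exact: integral_centered_normal_pdf2.
Qed.

Lemma bayes_predE x y :
  (\int[gauss_prior s]_t (gauss_pdf t v x * gauss_pdf t u y)) /
  (\int[gauss_prior s]_t gauss_pdf t v x) = bayes_pred s v u x y.
Proof.
rewrite /Rintegral integral_gauss_prior_pdf integral_gauss_prior_pdf2/=.
by rewrite mulrAC divff ?mul1r// gt_eqF// marginal_pdf_gt0.
Qed.

Lemma predictive_bayes_pred : predictive_density (bayes_pred s v u).
Proof.
split; [exact: measurable_bayes_pred|by move=> x y; rewrite ltW// bayes_pred_gt0|].
move=> x.
have := @ge0_integral_tuple_prod _ _ _ n (fun=> lebesgue_measure)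
  (fun i (t : measurableTypeR R) => gpdf (predictive_var v u (tnth s i))
                     (shrink v (tnth s i) * tnth x i) t) (fun=> 1).
rewrite big1//; apply.
- by move=> i; exact: measurable_normal_pdf.
- by move=> i t; exact: normal_pdf_ge0.
- by move=> i; exact: integral_normal_pdf.
Qed.

Lemma integral_marginal_pdf : (\int[leb]_x (marginal_pdf s v x)%:E = 1)%E.
Proof.
have := @ge0_integral_tuple_prod _ _ _ n (fun=> lebesgue_measure)
  (fun i (t : measurableTypeR R) => gpdf (tnth s i + v) 0 t) (fun=> 1).
rewrite big1//; apply.
- by move=> i; exact: measurable_normal_pdf.
- by move=> i t; exact: normal_pdf_ge0.
- by move=> i; exact: integral_normal_pdf.
Qed.

Section density_ratio.
Variable q : @Rvec R n -> @Rvec R n -> R.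
Hypothesis pq : predictive_density q.

Let h (z : @Rvec R n * @Rvec R n) : R := q z.1 z.2 / bayes_pred s v u z.1 z.2.

Let f (w : @Rvec R n * (@Rvec R n * @Rvec R n)) : \bar R :=
  ((gauss_pdf w.1 v w.2.1 * gauss_pdf w.1 u w.2.2)%:E * (h w.2)%:E)%E.

Lemma density_ratio_ge0 z : 0 <= q z.1 z.2 / bayes_pred s v u z.1 z.2.
Proof. by case: pq => _ q0 _; rewrite divr_ge0// ltW// bayes_pred_gt0. Qed.

Lemma measurable_density_ratio : measurable_fun setT
  (fun z : @Rvec R n * @Rvec R n => q z.1 z.2 / bayes_pred s v u z.1 z.2).
Proof.
case: pq => mq _ _; rewrite -/h.
(* The denominator is positive, so its inverse is a composition of the measurable functions [expR]
   and [ln]. *)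
rewrite (_ : h = fun z => q z.1 z.2 * expR (- ln (bayes_pred s v u z.1 z.2))).
  apply: measurable_funM => //; apply: measurableT_comp => //.
  apply: measurableT_comp => //; apply: measurableT_comp => //.
  exact: measurable_bayes_pred.
by apply/funext => z; rewrite expRN lnK// posrE bayes_pred_gt0.
Qed.

Let mf : measurable_fun setT f.
Proof.
apply: emeasurable_funM; apply/measurable_EFinP.
  apply: measurable_funM; apply: measurable_gauss_pdf => //;
    exact: measurableT_comp.
by apply: measurableT_comp => //; exact: measurable_density_ratio.
Qed.

Let f0 w : (0 <= f w)%E.
Proof.
rewrite mule_ge0// lee_fin; last exact: density_ratio_ge0.
by rewrite mulr_ge0// ltW// gauss_pdf_gt0.
Qed.

Let fE : (fun t => \int[gauss_law t v \x gauss_law t u]_z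
     (q z.1 z.2 / bayes_pred s v u z.1 z.2)%:E)%E =
  (fun t => \int[leb \x leb]_z f (t, z))%E.
Proof.
apply/funext => t; rewrite ge0_integral_gauss_law2//.
- by apply/measurable_EFinP; exact: measurable_density_ratio.
- by move=> z; rewrite lee_fin; exact: density_ratio_ge0.
Qed.

Lemma measurable_integral_density_ratio : measurable_fun setT
  (fun t => \int[gauss_law t v \x gauss_law t u]_z
     (q z.1 z.2 / bayes_pred s v u z.1 z.2)%:E)%E.
Proof. by rewrite fE; exact: measurable_integral_product. Qed.

(** Averaged over the prior, the joint density of the two observations is [marginal_pdf] times
    [bayes_pred]. The second factor cancels against the denominator, leaving the marginal times [q],
    which integrates to 1 in [y] and then in [x]. *)
Lemma integral_prior_density_ratio :
  (\int[gauss_prior s]_t \int[gauss_law t v \x gauss_law t u]_z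
     (q z.1 z.2 / bayes_pred s v u z.1 z.2)%:E = 1)%E.
Proof.
have [mq q0 q1] := pq.
rewrite fE ge0_integral_product_swap//.
pose k (z : @Rvec R n * @Rvec R n) : \bar R :=
  ((marginal_pdf s v z.1)%:E * (q z.1 z.2)%:E)%E.
have mk : measurable_fun setT k.
  apply: emeasurable_funM; apply/measurable_EFinP => //.
  apply: measurable_prod => i _.
  apply: measurable_normal_pdf2; [by rewrite ltr_wpDl|exact: measurable_cst|].
  exact: measurable_coord.
transitivity (\int[leb \x leb]_z k z)%E.
  apply: eq_integral => z _; rewrite /f /k/=.
  rewrite ge0_integralZr//.
  - rewrite integral_gauss_prior_pdf2 -!EFinM; congr EFin.
    rewrite /h -mulrA; congr (_ * _); rewrite mulrC divfK//.
    by rewrite gt_eqF// bayes_pred_gt0.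
  - apply/measurable_EFinP; apply: measurable_funM; exact: measurable_gauss_pdf.
  - by move=> t _; rewrite lee_fin mulr_ge0// ltW// gauss_pdf_gt0.
  - by rewrite lee_fin; exact: density_ratio_ge0.
rewrite fubini_tonelli1//; last first.
  by move=> z; rewrite mule_ge0// lee_fin// ltW// marginal_pdf_gt0.
rewrite /fubini_F /k/= -integral_marginal_pdf; apply: eq_integral => x _.
rewrite ge0_integralZl ?q1 ?mule1//.
- apply/measurable_EFinP.
  have mp : measurable_fun setT (fun y : @Rvec R n => (x, y)).
    exact: measurable_fun_pair.
  exact: (measurableT_comp mq mp).
- by move=> y _; rewrite lee_fin.
- by rewrite lee_fin ltW// marginal_pdf_gt0.
Qed.

End density_ratio.

End linear_predictive_density.

(** * Kullback-Leibler risk *)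

Section has_integral.
Context d (T : measurableType d) (R : realType) (mu : {measure set T -> \bar R}).
Implicit Types (f g : T -> R) (c e k : R).

(** Integrability is bundled with a real value so that signed integrands can be added, scaled and
    subtracted without extended-real side conditions. *)
Definition has_integral f c :=
  mu.-integrable setT (EFin \o f) /\ (\int[mu]_x (f x)%:E = c%:E)%E.

Lemma has_integral_ge0 f c : measurable_fun setT f -> (forall x, 0 <= f x) ->
  (\int[mu]_x (f x)%:E = c%:E)%E -> has_integral f c.
Proof.
move=> mf f0 fc; split => //; apply/integrableP; split; first exact/measurable_EFinP.
under eq_integral do rewrite /= ger0_norm//.
by rewrite fc ltry.
Qed.

Lemma has_integralD f g c e : has_integral f c -> has_integral g e ->
  has_integral (fun x => f x + g x) (c + e).
Proof.
move=> [fi fc] [gi ge]; split.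
  rewrite (_ : _ \o _ = (EFin \o f) \+ (EFin \o g))%E; first exact: integrableD.
  by apply/funext => x.
under eq_integral do rewrite EFinD.
by rewrite integralD//= fc ge.
Qed.

Lemma has_integralZ k f c : has_integral f c ->
  has_integral (fun x => k * f x) (k * c).
Proof.
move=> [fi fc]; split.
  rewrite (_ : _ \o _ = (fun x => k%:E * (EFin \o f) x))%E; first exact: integrableZl.
  by apply/funext => x.
under eq_integral do rewrite EFinM.
by rewrite integralZl//= fc.
Qed.

Lemma has_integralB f g c e : has_integral f c -> has_integral g e ->
  has_integral (fun x => f x - g x) (c - e).
Proof.
move=> fc /(has_integralZ (- 1)) ge.
rewrite -mulN1r (_ : (fun _ => _) = (fun x => f x + -1 * g x)); last first.
  by apply/funext => x; rewrite mulN1r.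
exact: has_integralD.
Qed.

Lemma has_integral_cst k : mu setT = 1%E -> has_integral (cst k) k.
Proof.
move=> mu1.
have h1 : has_integral (cst 1) 1.
  by apply: has_integral_ge0 => //; exact: (integral_cst1 mu1).
rewrite -[X in has_integral _ X]mulr1.
rewrite (_ : cst k = (fun x => k * cst 1 x)); last first.
  by apply/funext => x /=; rewrite mulr1.
exact: has_integralZ.
Qed.

Lemma has_integral_sum (I : Type) (r : seq I) (f : I -> T -> R) (c : I -> R) :
  mu setT = 1%E -> (forall i, has_integral (f i) (c i)) ->
  has_integral (fun x => \sum_(i <- r) f i x) (\sum_(i <- r) c i).
Proof.
move=> mu1 fc; elim: r => [|i r ih].
  rewrite big_nil (_ : (fun _ => _) = cst 0); first exact: has_integral_cst.
  by apply/funext => x; rewrite big_nil.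
rewrite big_cons (_ : (fun _ => _) = (fun x => f i x + \sum_(i <- r) f i x)).
  exact: has_integralD.
by apply/funext => x; rewrite big_cons.
Qed.

(** The upper function may take infinite values, as the log-ratio does where the predictive density
    vanishes. Positive and negative parts are compared separately. *)
Lemma has_integral_le f c (g : T -> \bar R) : has_integral f c ->
  measurable_fun setT g -> (forall x, (f x)%:E <= g x)%E ->
  (c%:E <= \int[mu]_x g x)%E.
Proof.
move=> [fi fc] mg fg; rewrite -fc.
have mf := measurable_int mu fi.
rewrite [leLHS]integralE [leRHS]integralE; apply: leeB.
- apply: ge0_le_integral => //; first exact: measurable_funepos.
    exact: measurable_funepos.
  by move=> x _; apply: (@funepos_le _ _ setT) => [y _|]; rewrite ?inE//; exact: fg.
- apply: ge0_le_integral => //; first exact: measurable_funeneg.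
    exact: measurable_funeneg.
  by move=> x _; apply: (@funeneg_le _ _ setT) => [y _|]; rewrite ?inE//; exact: fg.
Qed.

End has_integral.

Section kl_risk.
Context {R : realType}.
Variable n : nat.
Implicit Types (theta s x y : @Rvec R n) (v u : R).
Local Notation gpdf v c x := (normal_pdf c (Num.sqrt v) x).

Lemma ln_prod (I : Type) (r : seq I) (f : I -> R) : (forall i, 0 < f i) ->
  ln (\prod_(i <- r) f i) = \sum_(i <- r) ln (f i).
Proof.
move=> f0; elim: r => [|i r ih]; first by rewrite !big_nil ln1.
by rewrite !big_cons lnM ?posrE ?ih// prodr_gt0.
Qed.

Lemma ln_normal_pdf_ratio (v u c e x : R) : 0 < v -> 0 < u ->
  ln (gpdf u c x) - ln (gpdf v e x) =
  2^-1 * ln (v / u) + ((x - e) ^+ 2 / (v *+ 2) - (x - c) ^+ 2 / (u *+ 2)).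
Proof.
move=> v0 u0.
have lns (w : R) : 0 < w -> ln (Num.sqrt w) = 2^-1 * ln w.
  move=> w0; rewrite -[in RHS](@sqr_sqrtr _ w) ?ltW// lnXn ?sqrtr_gt0//.
  by field.
have g (w : R) : 0 < w -> 0 < w * pi *+ 2.
  by move=> w0; rewrite mulrn_wgt0// mulr_gt0// pi_gt0.
have lnp (w a b : R) : 0 < w -> ln (gpdf w a b) =
    - (2^-1 * (ln w + ln (pi *+ 2))) - (b - a) ^+ 2 / (w *+ 2).
  move=> w0; rewrite normal_pdf_var// lnM ?posrE ?expR_gt0//; last first.
    by rewrite invr_gt0 sqrtr_gt0 g.
  rewrite expRK lnV ?posrE ?sqrtr_gt0 ?g// lns ?g// -mulrnAr lnM ?posrE//.
    by rewrite mulNr.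
  by rewrite mulrn_wgt0// pi_gt0.
by rewrite !lnp// ln_div ?posrE//; ring.
Qed.

(* The risk of the coordinatewise Bayes rule for the prior N(0,t), at a
   parameter whose square is [a]. *)
Definition coord_risk v u (t a : R) : R :=
  2^-1 * ln (predictive_var v u t / u) +
  (((1 - shrink v t) ^+ 2 * a + shrink v t ^+ 2 * v + u) /
     (predictive_var v u t *+ 2) - 2^-1).

Definition bayes_pred_risk s v u theta : R :=
  \sum_(i < n) coord_risk v u (tnth s i) (tnth theta i ^+ 2).

Variables (s : @Rvec R n) (v u : R).
Hypotheses (s0 : forall i, 0 <= (tnth s i : R)) (v0 : 0 < v) (u0 : 0 < u).

Lemma has_integral_log_ratio theta :
  has_integral (gauss_law theta v \x gauss_law theta u)%E
    (fun z => ln (gauss_pdf theta u z.2) - ln (bayes_pred s v u z.1 z.2))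
    (bayes_pred_risk s v u theta).
Proof.
have affine i alpha beta : has_integral (gauss_law theta v \x gauss_law theta u)%E
    (fun z => (alpha + tnth z.2 i - beta * tnth z.1 i) ^+ 2)
    ((alpha + (1 - beta) * tnth theta i) ^+ 2 + beta ^+ 2 * v + u).
  apply: has_integral_ge0.
  - apply: measurable_funX; apply: measurable_funB.
      by apply: measurable_funD => //; exact: measurable_coord.
    by apply: measurable_funM => //; exact: measurable_coord.
  - by move=> z; exact: sqr_ge0.
  - exact: integral_gauss_law2_affine_sqr.
have pv i := predictive_var_gt0 v0 u0 (s0 i).
(* Both squares are put in the form of [affine]: the first with [alpha = 0] and [beta] the shrinkage
   factor, the second with [alpha = - tnth theta i] and [beta = 0]. *)
rewrite (_ : (fun z => _) = (fun z => \sum_(i < n)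
   (2^-1 * ln (predictive_var v u (tnth s i) / u) +
    ((predictive_var v u (tnth s i) *+ 2)^-1 *
       (0 + tnth z.2 i - shrink v (tnth s i) * tnth z.1 i) ^+ 2 -
     (u *+ 2)^-1 * (- tnth theta i + tnth z.2 i - 0 * tnth z.1 i) ^+ 2)))); last first.
  apply/funext => z; rewrite !ln_prod//; last 2 first.
  - by move=> i; exact: normal_pdf_var_gt0.
  - by move=> i; exact: normal_pdf_var_gt0.
  rewrite -sumrB; apply: eq_bigr => i _; rewrite ln_normal_pdf_ratio//.
  by rewrite mul0r subr0 add0r (addrC (- _)) ![_^-1 * _]mulrC.
apply: has_integral_sum; first exact: gauss_law2_setT.
move=> i; apply: has_integralD; first by apply: has_integral_cst; exact: gauss_law2_setT.
(* The [2^-1] in [coord_risk] is the mean of the squared noise of the second observation divided by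
   [2 * u]. *)
rewrite (_ : 2^-1 = (u *+ 2)^-1 *
    ((- tnth theta i + (1 - 0) * tnth theta i) ^+ 2 + 0 ^+ 2 * v + u)); last first.
  by field; rewrite gt_eqF.
apply: has_integralB; last by apply: has_integralZ; exact: affine.
rewrite [X in has_integral _ _ X]mulrC; apply: has_integralZ.
rewrite -exprMn -[X in X ^+ 2 + _]add0r.
exact: affine.
Qed.

Lemma measurable_log_ratio theta (q : @Rvec R n -> @Rvec R n -> R) :
  predictive_density q ->
  measurable_fun setT (fun z : @Rvec R n * @Rvec R n =>
    lne ((gauss_pdf theta u z.2)%:E / (q z.1 z.2)%:E)%E).
Proof.
move=> [mq q0 _].
have mp : measurable_fun setT (fun z : @Rvec R n * @Rvec R n => gauss_pdf theta u z.2).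
  exact: measurable_gauss_pdf.
(* The zero set of [q] is split off; elsewhere the extended logarithm is a real difference. *)
rewrite (_ : (fun z => _) = (fun z => if q z.1 z.2 == 0 then +oo%E else
   (ln (gauss_pdf theta u z.2) - ln (q z.1 z.2))%:E)).
  apply: measurable_fun_ifT => //.
    exact: measurable_fun_eqr.
  apply/measurable_EFinP; apply: measurable_funB.
    by apply: measurableT_comp => //; exact: measurable_ln.
  by apply: (measurableT_comp (@measurable_ln R)).
apply/funext => z; have p0 := gauss_pdf_gt0 theta z.2 u0.
case: eqVneq => [->|qn0]; first by rewrite inve0 gt0_muley ?lte_fin.
rewrite inver (negbTE qn0) -EFinM lne_EFin; last first.
  by rewrite divr_gt0// lt_neqAle eq_sym qn0 q0.
by rewrite ln_div ?posrE// lt_neqAle eq_sym qn0 q0.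
Qed.

(* Pointwise, ln (p/q) >= ln (p/p') + 1 - q/p' because ln t >= 1 - 1/t. *)
Lemma log_ratio_ge theta (q : @Rvec R n -> @Rvec R n -> R) z :
  predictive_density q ->
  (((ln (gauss_pdf theta u z.2) - ln (bayes_pred s v u z.1 z.2)) + 1
   - q z.1 z.2 / bayes_pred s v u z.1 z.2)%:E <=
   lne ((gauss_pdf theta u z.2)%:E / (q z.1 z.2)%:E))%E.
Proof.
move=> [_ q0 _]; have p0 := gauss_pdf_gt0 theta z.2 u0.
have b0 := bayes_pred_gt0 s0 v0 u0 z.1 z.2.
case: (eqVneq (q z.1 z.2) 0) => [->|qn0].
  by rewrite inve0 gt0_muley ?lte_fin//= leey.
have {qn0}qp : 0 < q z.1 z.2 by rewrite lt_neqAle eq_sym qn0 q0.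
rewrite inver gt_eqF// -EFinM lne_EFin ?divr_gt0// lee_fin ln_div ?posrE//.
have r0 : 0 < q z.1 z.2 / bayes_pred s v u z.1 z.2 by rewrite divr_gt0.
have := @le_ln1Dx _ (q z.1 z.2 / bayes_pred s v u z.1 z.2 - 1).
rewrite (addrC 1) subrK ln_div ?posrE// => h.
have {}h : ln (q z.1 z.2) - ln (bayes_pred s v u z.1 z.2) <=
    q z.1 z.2 / bayes_pred s v u z.1 z.2 - 1.
  by apply: h; rewrite ltrBDr addrC subrr.
lra.
Qed.

(** This integrates [log_ratio_ge]. Stating it as a lower bound on the mean density ratio keeps it
    valid, trivially, at parameters where that mean is infinite. *)
Lemma kl_integral_lower_bound theta (q : @Rvec R n -> @Rvec R n -> R) (M : R) :
  predictive_density q ->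
  (\int[gauss_law theta v \x gauss_law theta u]_z
     lne ((gauss_pdf theta u z.2)%:E / (q z.1 z.2)%:E) <= M%:E)%E ->
  ((bayes_pred_risk s v u theta + 1 - M)%:E <=
    \int[gauss_law theta v \x gauss_law theta u]_z
     (q z.1 z.2 / bayes_pred s v u z.1 z.2)%:E)%E.
Proof.
move=> pq FM; set G := (X in (_ <= X)%E).
have G0 : (0 <= G)%E.
  by apply: integral_ge0 => z _; rewrite lee_fin; exact: density_ratio_ge0.
have mh := measurable_density_ratio s0 v0 u0 pq.
have [Goo|Gfin] := eqVneq G +oo%E; first by rewrite Goo leey.
have {}Gfin : G \is a fin_num by rewrite ge0_fin_numE// lt_neqAle Gfin leey.
have hG : has_integral (gauss_law theta v \x gauss_law theta u)%E
    (fun z => q z.1 z.2 / bayes_pred s v u z.1 z.2) (fine G).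
  apply: has_integral_ge0 => //; first by move=> z; exact: density_ratio_ge0.
  by rewrite fineK.
have h1 := has_integral_cst 1 (gauss_law2_setT theta v u).
have hk := has_integralB (has_integralD (has_integral_log_ratio theta) h1) hG.
have := has_integral_le hk (measurable_log_ratio theta pq)
  (fun z => log_ratio_ge theta z pq).
by move=> /le_trans /(_ FM); rewrite -[G]fineK// !lee_fin; lra.
Qed.

Lemma integral_log_bayes_pred theta :
  (\int[gauss_law theta v \x gauss_law theta u]_z
     lne ((gauss_pdf theta u z.2)%:E / (bayes_pred s v u z.1 z.2)%:E) =
   (bayes_pred_risk s v u theta)%:E)%E.
Proof.
have [_ <-] := has_integral_log_ratio theta; apply: eq_integral => z _.
have b0 := bayes_pred_gt0 s0 v0 u0 z.1 z.2.
have p0 := gauss_pdf_gt0 theta z.2 u0.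
by rewrite inver gt_eqF// -EFinM lne_EFin ?divr_gt0// ln_div.
Qed.

End kl_risk.

(** * The Bayes lower bound *)

Section prior_moments.
Context {R : realType}.
Variables (n : nat) (s : @Rvec R n).
Hypothesis s0 : forall i, 0 <= (tnth s i : R).

Lemma centered_normal_setT (t : R) : centered_normal t setT = 1%E.
Proof.
by rewrite /centered_normal; case: ifP => _; [exact: diracT|exact: probability_setT].
Qed.

Lemma gauss_prior_setT : gauss_prior s setT = 1%E.
Proof. by apply: tuple_measure_setT => i; exact: centered_normal_setT. Qed.

Lemma integral_centered_normal_sqr (t : R) : 0 <= t ->
  (\int[centered_normal t]_x (x ^+ 2)%:E = t%:E)%E.
Proof.
move=> t0; rewrite /centered_normal; case: ifPn => [/eqP->|tn0].
  rewrite integral_dirac//; first by rewrite diracT mul1e expr0n.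
  by apply/measurable_EFinP; exact: measurable_funX.
have {tn0}tp : 0 < t by rewrite lt_neqAle eq_sym tn0.
have sp : 0 < Num.sqrt t by rewrite sqrtr_gt0.
have := integral_normal_sqr 0 sp; rewrite sqr_sqrtr// => <-.
by apply: eq_integral => x _; rewrite subr0.
Qed.

Lemma integral_centered_normal_pow4 (t : R) : 0 <= t ->
  exists2 c, c <= 32 * t ^+ 2 & (\int[centered_normal t]_x (x ^+ 4)%:E = c%:E)%E.
Proof.
move=> t0; rewrite /centered_normal; case: ifPn => [/eqP->|tn0].
  exists 0; first by rewrite expr0n/= mulr0.
  rewrite integral_dirac//; first by rewrite diracT mul1e expr0n.
  by apply/measurable_EFinP; exact: measurable_funX.
have {tn0}tp : 0 < t by rewrite lt_neqAle eq_sym tn0.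
have sp : 0 < Num.sqrt t by rewrite sqrtr_gt0.
have := integral_normal_pow4_le 0 sp.
rewrite (exprM _ 2 2) sqr_sqrtr//.
under eq_integral do rewrite subr0.
set I := (X in (X <= _)%E) => Ile.
have I0 : (0 <= I)%E by apply: integral_ge0 => x _; rewrite lee_fin exprn_even_ge0.
have Ifin : I \is a fin_num by rewrite ge0_fin_numE// (le_lt_trans Ile) ?ltry.
exists (fine I); last by rewrite fineK.
by rewrite -lee_fin fineK.
Qed.

Let mX k i : measurable_fun setT (fun t : @Rvec R n => (tnth t i : R) ^+ k).
Proof. by apply: measurable_funX; exact: measurable_coord. Qed.

Lemma has_integral_prior_sqr i :
  has_integral (gauss_prior s) (fun t => tnth t i ^+ 2) (tnth s i).
Proof.
apply: has_integral_ge0 => //; first by move=> t; exact: sqr_ge0.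
apply: (@ge0_integral_tuple_tnth _ _ _ _ _ i (fun t : measurableTypeR R => t ^+ 2)).
- by move=> j; exact: centered_normal_setT.
- exact: measurable_funX.
- by move=> t; exact: sqr_ge0.
- exact: integral_centered_normal_sqr.
Qed.

(** Covariances of the squared coordinates: independence kills the off-diagonal ones, and the fourth
    moment bounds the diagonal ones. *)
Lemma has_integral_prior_centered_sqr_prod i j :
  exists2 c, c <= (if i == j then 32 * (tnth s i : R) ^+ 2 else 0) &
  has_integral (gauss_prior s)
    (fun t => (tnth t i ^+ 2 - tnth s i) * (tnth t j ^+ 2 - tnth s j)) c.
Proof.
have [c cle hc] : exists2 c, c <= (if i == j then 32 * (tnth s i : R) ^+ 2
                                   else tnth s i * tnth s j) &
    has_integral (gauss_prior s) (fun t => tnth t i ^+ 2 * tnth t j ^+ 2) c.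
  case: eqVneq => [<-|ij].
    have [c cle ic] := integral_centered_normal_pow4 (s0 i).
    exists c => //; rewrite (_ : (fun _ => _) = (fun t : @Rvec R n => tnth t i ^+ 4)).
      apply: has_integral_ge0 => //; first by move=> t; exact: exprn_even_ge0.
      apply: (@ge0_integral_tuple_tnth _ _ _ _ _ i
        (fun t : measurableTypeR R => t ^+ 4)) => //.
      - by move=> k; exact: centered_normal_setT.
      - by move=> t; exact: exprn_even_ge0.
    by apply/funext => t; rewrite -exprD.
  exists (tnth s i * tnth s j) => //.
  apply: has_integral_ge0.
  - exact: measurable_funM.
  - by move=> t; rewrite mulr_ge0// sqr_ge0.
  - apply: (@ge0_integral_tuple_tnth2 _ _ _ _ _ i j
      (fun t : measurableTypeR R => t ^+ 2) (fun t : measurableTypeR R => t ^+ 2)) => //.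
    + by move=> k; exact: centered_normal_setT.
    + by move=> t; exact: sqr_ge0.
    + by move=> t; exact: sqr_ge0.
    + exact: integral_centered_normal_sqr.
    + exact: integral_centered_normal_sqr.
exists (c - tnth s i * tnth s j - tnth s j * tnth s i + tnth s i * tnth s j).
  by move: cle; case: eqP => [<-|_]; have := s0 i; nra.
rewrite (_ : (fun _ => _) = (fun t => tnth t i ^+ 2 * tnth t j ^+ 2
    - tnth s i * tnth t j ^+ 2 - tnth s j * tnth t i ^+ 2
    + cst (tnth s i * tnth s j) t)).
  apply: has_integralD; last by apply: has_integral_cst; exact: gauss_prior_setT.
  apply: has_integralB; last by apply: has_integralZ; exact: has_integral_prior_sqr.
  by apply: has_integralB => //; apply: has_integralZ; exact: has_integral_prior_sqr.
by apply/funext => t /=; ring.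
Qed.

(** The variance of the quadratic form expands into a double sum of covariances, of which only the
    diagonal can be positive. *)
Lemma has_integral_prior_quadratic (A : 'I_n -> R) : (forall i, 0 <= A i) ->
  exists2 W, W <= 32 * \sum_(i < n) A i ^+ 2 * (tnth s i : R) ^+ 2 &
  has_integral (gauss_prior s) (fun t =>
    (\sum_(i < n) A i * tnth t i ^+ 2 - \sum_(i < n) A i * tnth s i) ^+ 2) W.
Proof.
move=> A0; pose c i j := sval (cid2 (has_integral_prior_centered_sqr_prod i j)).
have cle i j : c i j <= (if i == j then 32 * (tnth s i : R) ^+ 2 else 0).
  by rewrite /c; case: cid2.
have hc i j : has_integral (gauss_prior s)
    (fun t => (tnth t i ^+ 2 - tnth s i) * (tnth t j ^+ 2 - tnth s j)) (c i j).
  by rewrite /c; case: cid2.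
exists (\sum_(i < n) A i * \sum_(j < n) A j * c i j).
  rewrite mulr_sumr; apply: ler_sum => i _.
  rewrite (bigD1 i)//= mulrDr -[leRHS]addr0 lerD//.
    have := cle i i; rewrite eqxx => h.
    have -> : 32 * (A i ^+ 2 * tnth s i ^+ 2) = A i * (A i * (32 * tnth s i ^+ 2)).
      by ring.
    by rewrite !ler_wpM2l.
  rewrite mulr_ge0_le0// sumr_le0// => j ji.
  by rewrite mulr_ge0_le0//; have := cle i j; rewrite eq_sym (negbTE ji).
rewrite (_ : (fun _ => _) = (fun t => \sum_(i < n) A i * \sum_(j < n) A j *
    ((tnth t i ^+ 2 - tnth s i) * (tnth t j ^+ 2 - tnth s j)))).
  apply: has_integral_sum; first exact: gauss_prior_setT.
  move=> i; apply: has_integralZ; apply: has_integral_sum; first exact: gauss_prior_setT.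
  by move=> j; exact: has_integralZ.
apply/funext => t; rewrite -sumrB expr2 mulr_suml; apply: eq_bigr => i _.
rewrite -mulrBr -mulrA mulr_sumr; congr (_ * _); apply: eq_bigr => j _.
by rewrite -mulrBr; ring.
Qed.

End prior_moments.

Section bayes_lower_bound.
Context {R : realType}.
Variables (n : nat) (s : @Rvec R n) (v u : R).
Hypotheses (s0 : forall i, 0 <= (tnth s i : R)) (v0 : 0 < v) (u0 : 0 < u).

Lemma has_integral_bayes_pred_risk :
  has_integral (gauss_prior s) (bayes_pred_risk s v u)
    (\sum_(i < n) coord_risk v u (tnth s i) (tnth s i)).
Proof.
apply: has_integral_sum; first exact: gauss_prior_setT.
move=> i; apply: has_integralD.
  by apply: has_integral_cst; exact: gauss_prior_setT.
apply: has_integralB; last by apply: has_integral_cst; exact: gauss_prior_setT.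
rewrite (_ : (fun _ => _) = (fun t => (predictive_var v u (tnth s i) *+ 2)^-1 *
   ((1 - shrink v (tnth s i)) ^+ 2 * tnth t i ^+ 2 +
    cst (shrink v (tnth s i) ^+ 2 * v + u) t))); last first.
  by apply/funext => t /=; rewrite mulrC addrA.
rewrite [X in has_integral _ _ X]mulrC -addrA; apply: has_integralZ.
apply: has_integralD; first by apply: has_integralZ; exact: has_integral_prior_sqr.
by apply: has_integral_cst; exact: gauss_prior_setT.
Qed.

(* The comparison is made pointwise in the parameter: on [D] by the lower bound
   on the risk of [q], off [D] by the square of the centered quadratic form,
   whose prior mean is small. *)
Lemma bayes_lower_bound (A : 'I_n -> R) (D : set (@Rvec R n)) q (M K : R) :
  (forall i, 0 <= A i) -> predictive_density q -> 0 <= M -> 0 <= K ->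
  (forall t, D t ->
    \int[gauss_law t v \x gauss_law t u]_z
      lne ((gauss_pdf t u z.2)%:E / (q z.1 z.2)%:E) <= M%:E)%E ->
  (forall t, ~ D t -> bayes_pred_risk s v u t + 1 <=
    K * (\sum_(i < n) A i * tnth t i ^+ 2 - \sum_(i < n) A i * tnth s i) ^+ 2) ->
  \sum_(i < n) coord_risk v u (tnth s i) (tnth s i) <=
    M + K * (32 * \sum_(i < n) A i ^+ 2 * (tnth s i : R) ^+ 2).
Proof.
move=> A0 pq M0 K0 inD outD.
have [W Wle hW] := has_integral_prior_quadratic s0 A0.
have h1 := has_integral_cst (1 - M) (gauss_prior_setT s).
have hk := has_integralB (has_integralD has_integral_bayes_pred_risk h1)
  (has_integralZ K hW).
have := has_integral_le hk (measurable_integral_density_ratio s0 v0 u0 pq).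
(* The mean of the density ratio is 1, so a pointwise bound by that ratio integrates to a bound by
   1. *)
rewrite integral_prior_density_ratio// lee_fin => h.
have KW : K * W <= K * (32 * \sum_(i < n) A i ^+ 2 * (tnth s i : R) ^+ 2).
  by rewrite ler_wpM2l.
suff : \sum_(i < n) coord_risk v u (tnth s i) (tnth s i) + (1 - M) - K * W <= 1 by lra.
apply: h => t /=.
have [Dt|nDt] := pselect (D t).
  apply: le_trans (kl_integral_lower_bound s0 v0 u0 pq (inD t Dt)).
  rewrite lee_fin.
  have : 0 <= K *
      (\sum_(i < n) A i * tnth t i ^+ 2 - \sum_(i < n) A i * tnth s i) ^+ 2.
    by rewrite mulr_ge0// sqr_ge0.
  lra.
apply: (@le_trans _ _ 0%E); first by rewrite lee_fin; have := outD t nDt; lra.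
by apply: integral_ge0 => z _; rewrite lee_fin; exact: density_ratio_ge0.
Qed.

End bayes_lower_bound.

(** * The least favorable variances *)

Section coordinate_risk.
Context {R : realType}.
Variables (v u : R).
Hypotheses (v0 : 0 < v) (u0 : 0 < u).
Implicit Types t r e a : R.

Definition bayes_risk (t : R) : R := coord_risk v u t t.

(** The coefficient of [a] in [coord_risk v u t a]; it is also the derivative of [bayes_risk] at
    [t], which links the affine risk of a fixed rule to the concave Bayes risk. *)
Definition risk_slope (t : R) : R :=
  (1 - shrink v t) ^+ 2 / (predictive_var v u t *+ 2).

Lemma coord_risk_affine t a :
  coord_risk v u t a = bayes_risk t + risk_slope t * (a - t).
Proof. by rewrite /bayes_risk /coord_risk /risk_slope; ring. Qed.

Let pv t : 0 <= t -> 0 < predictive_var v u t.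
Proof. exact: predictive_var_gt0. Qed.

Let tv t : 0 <= t -> 0 < t + v. Proof. by move=> t0; rewrite ltr_wpDl. Qed.

Lemma bayes_riskE t : 0 <= t ->
  bayes_risk t = 2^-1 * ln (predictive_var v u t / u).
Proof.
move=> t0; rewrite /bayes_risk /coord_risk -[RHS]addr0; congr (_ + _).
have -> : (1 - shrink v t) ^+ 2 * t + shrink v t ^+ 2 * v + u = predictive_var v u t.
  by rewrite /predictive_var /shrink; field; rewrite gt_eqF ?tv.
by field; rewrite gt_eqF ?pv.
Qed.

Lemma bayes_risk0 : bayes_risk 0 = 0.
Proof.
by rewrite bayes_riskE// /predictive_var /shrink mul0r mul0r add0r divff ?gt_eqF// ln1 mulr0.
Qed.

(** The denominator factors into two linear terms in [t], so equating the slope to a multiple of the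
    weight is a quadratic equation, the one [theta_sq] solves. *)
Lemma risk_slopeE t : 0 <= t ->
  risk_slope t = (v - u * v / (u + v)) / 2 / ((t + v) * (t + u * v / (u + v))).
Proof.
move=> t0; rewrite /risk_slope /predictive_var /shrink.
have uv : 0 < u + v by rewrite addr_gt0.
have h1 : 0 < t * v + u * (t + v) by rewrite ltr_wpDl ?mulr_gt0 ?tv// mulr_ge0// ltW.
by field; rewrite !gt_eqF//; nra.
Qed.

Lemma risk_slope_ge0 t : 0 <= t -> 0 <= risk_slope t.
Proof.
by move=> t0; rewrite divr_ge0 ?sqr_ge0// mulrn_wge0// ltW// pv.
Qed.

(** Concavity. The bound [ln (1 + z) <= z] reduces it to rational functions, whose difference is a
    nonnegative multiple of [(r - t) ^+ 2]. *)
Lemma bayes_risk_le_tangent t r : 0 <= t -> 0 <= r ->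
  bayes_risk r <= bayes_risk t + risk_slope t * (r - t).
Proof.
move=> t0 r0; rewrite !bayes_riskE// -lerBlDl -mulrBr -ln_div ?posrE ?divr_gt0 ?pv//.
have -> : predictive_var v u r / u / (predictive_var v u t / u) =
          1 + (predictive_var v u r / predictive_var v u t - 1).
  by field; rewrite !gt_eqF ?pv.
have rt0 : 0 < predictive_var v u r / predictive_var v u t by rewrite divr_gt0 ?pv.
apply: (@le_trans _ _ (2^-1 * (predictive_var v u r / predictive_var v u t - 1))).
  by rewrite ler_wpM2l ?invr_ge0// le_ln1Dx// ltrBDr addrC subrr.
have pt := pv t0; have tp := tv t0; have rp := tv r0.
have -> : 2^-1 * (predictive_var v u r / predictive_var v u t - 1) =
    v ^+ 2 * (r - t) / ((r + v) * (t + v) * (predictive_var v u t *+ 2)).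
  rewrite [in predictive_var v u r]/predictive_var.
  have -> : shrink v r * v + u =
      predictive_var v u t + v ^+ 2 * (r - t) / ((r + v) * (t + v)).
    by rewrite /predictive_var /shrink; field; rewrite !gt_eqF.
  by field; rewrite !gt_eqF.
have -> : risk_slope t * (r - t) =
    v ^+ 2 * (r - t) / ((t + v) * (t + v) * (predictive_var v u t *+ 2)).
  rewrite /risk_slope; have -> : 1 - shrink v t = v / (t + v).
    by rewrite /shrink; field; rewrite gt_eqF.
  by field; rewrite !gt_eqF.
rewrite -subr_ge0.
have -> : v ^+ 2 * (r - t) / ((t + v) * (t + v) * (predictive_var v u t *+ 2)) -
    v ^+ 2 * (r - t) / ((r + v) * (t + v) * (predictive_var v u t *+ 2)) =
   v ^+ 2 * (r - t) ^+ 2 / ((r + v) * (t + v) ^+ 2 * (predictive_var v u t *+ 2)).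
  by field; rewrite !gt_eqF.
apply: divr_ge0; first by rewrite mulr_ge0// sqr_ge0.
apply: mulr_ge0; last by rewrite mulrn_wge0// ltW.
by rewrite mulr_ge0 ?sqr_ge0// ltW.
Qed.

Lemma slope_mul_le_bayes_risk t : 0 <= t -> risk_slope t * t <= bayes_risk t.
Proof.
by move=> t0; have := bayes_risk_le_tangent t0 (lexx 0); rewrite bayes_risk0; lra.
Qed.

Lemma bayes_risk_ge0 t : 0 <= t -> 0 <= bayes_risk t.
Proof.
move=> t0; apply: le_trans (slope_mul_le_bayes_risk t0).
by rewrite mulr_ge0 ?risk_slope_ge0.
Qed.

(** Concavity with value 0 at 0: the tangent at [(1 - e) * t] is compared at [t] and at 0, with
    weights [1 - e] and [e]. *)
Lemma bayes_risk_shrink t e : 0 <= t -> 0 <= e <= 1 ->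
  (1 - e) * bayes_risk t <= bayes_risk ((1 - e) * t).
Proof.
move=> t0 /andP[e0 e1]; have e1' : 0 <= 1 - e by lra.
have r0 : 0 <= (1 - e) * t by rewrite mulr_ge0.
have h1 := bayes_risk_le_tangent r0 t0.
have h2 := slope_mul_le_bayes_risk r0.
have h3 : (1 - e) * bayes_risk t <=
  (1 - e) * (bayes_risk ((1 - e) * t) +
             risk_slope ((1 - e) * t) * (t - (1 - e) * t)).
  by rewrite ler_wpM2l.
have h4 : e * (risk_slope ((1 - e) * t) * ((1 - e) * t)) <=
    e * bayes_risk ((1 - e) * t).
  by rewrite ler_wpM2l.
lra.
Qed.

Lemma bayes_risk_le t e : 0 <= t -> 0 <= e <= 1 ->
  bayes_risk ((1 - e) * t) <= bayes_risk t.
Proof.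
move=> t0 /andP[e0 e1].
have r0 : 0 <= (1 - e) * t by rewrite mulr_ge0//; lra.
apply: (le_trans (bayes_risk_le_tangent t0 r0)).
have := risk_slope_ge0 t0 => s0.
have : 0 <= risk_slope t * (e * t) by apply: mulr_ge0 => //; exact: mulr_ge0.
lra.
Qed.

(** For [e] at most one half, each of the two linear factors in the denominator loses at most a
    factor 2. *)
Lemma risk_slope_shrink t e : 0 <= t -> 0 <= e <= 2^-1 ->
  risk_slope ((1 - e) * t) <= 4 * risk_slope t.
Proof.
move=> t0 /andP[e0 e1].
have r0 : 0 <= (1 - e) * t by rewrite mulr_ge0//; lra.
have half_le z : 0 < z -> (t + z) / 2 <= (1 - e) * t + z.
  by have : e * t <= 2^-1 * t; [rewrite ler_wpM2r|lra].
have a1 := half_le _ v0.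
rewrite !risk_slopeE//; set v' := u * v / (u + v); set w := v - v'.
have uv : 0 < u + v by rewrite addr_gt0.
have v'0 : 0 < v' by rewrite divr_gt0// mulr_gt0.
have w0 : 0 <= w / 2.
  rewrite divr_ge0// /w /v' (_ : v - _ = v ^+ 2 / (u + v)).
    by rewrite divr_ge0 ?sqr_ge0// ltW.
  by field; rewrite gt_eqF.
have a2 := half_le _ v'0.
rewrite mulrCA ler_wpM2l// -[leRHS]invrK lef_pV2 ?posrE.
- rewrite invfM invrK.
  apply: (@le_trans _ _ (((t + v) / 2) * ((t + v') / 2))).
    by rewrite le_eqVlt; apply/orP; left; apply/eqP; field.
  by apply: ler_pM => //; rewrite divr_ge0// addr_ge0// ltW.
- by rewrite mulr_gt0// ltr_wpDl.
- by rewrite invr_gt0 mulr_gt0// invr_gt0 mulr_gt0 ?tv// ltr_wpDl.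
Qed.

End coordinate_risk.

(** Beyond [C], the squared deviation of [T] from [(1 - e) * C] dominates both constants and linear
    terms in [T]; this absorbs the affine risk outside the ellipsoid. *)
Lemma excess_sqr_le (R : realType) (C e T : R) : 0 < C -> 0 < e -> e <= 2^-1 ->
  C < T ->
  (e * C) ^+ 2 <= (T - (1 - e) * C) ^+ 2 /\
  (e * C) ^+ 2 * T <= C * (T - (1 - e) * C) ^+ 2.
Proof.
move=> C0 e0 e1 CT; have x0 : 0 < T - C by lra.
have ec : 0 < e * C by rewrite mulr_gt0.
split; first by rewrite ler_sqr ?nnegrE; lra.
have -> : T = C + (T - C) by ring.
move: (T - C) x0 => x x0.
have -> : C * (C + x - (1 - e) * C) ^+ 2 =
  (e * C) ^+ 2 * (C + x) + C * x * (x + (2 - e) * (e * C)) by ring.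
rewrite lerDl mulr_ge0 ?mulr_ge0 ?ltW// ltr_wpDr// mulr_ge0 ?(ltW ec)//.
lra.
Qed.

(** * The saddle point and the shrunken prior *)

Section least_favorable.
Context {R : realType}.
Variables (n : nat) (v u C mu : R) (A t : 'I_n -> R).
Hypotheses (v0 : 0 < v) (u0 : 0 < u) (C0 : 0 < C) (mu0 : 0 <= mu).
Hypotheses (A0 : forall i, 0 < A i) (t0 : forall i, 0 <= t i).
(* Karush-Kuhn-Tucker conditions for maximizing the total Bayes risk under the
   constraint, with multiplier [mu]. *)
Hypotheses (slope_le : forall i, risk_slope v u (t i) <= mu * A i)
  (slope_eq : forall i, risk_slope v u (t i) * t i = mu * A i * t i)
  (constraint : \sum_(i < n) A i * t i = C).

Definition total_risk : R := \sum_(i < n) bayes_risk v u (t i).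

(** The risk is affine in [r], and by the Karush-Kuhn-Tucker conditions its increment over [t] is at
    most [mu] times the increment of the constraint, which is nonpositive. *)
Lemma total_risk_saddle (r : 'I_n -> R) : (forall i, 0 <= r i) ->
  \sum_(i < n) A i * r i <= C ->
  \sum_(i < n) coord_risk v u (t i) (r i) <= total_risk.
Proof.
move=> r0 rC.
apply: (@le_trans _ _
  (\sum_(i < n) (bayes_risk v u (t i) + mu * (A i * r i - A i * t i)))).
  apply: ler_sum => i _; rewrite coord_risk_affine lerD2l.
  have := ler_wpM2r (r0 i) (slope_le i); have := slope_eq i; lra.
rewrite big_split/= -mulr_sumr sumrB constraint gerDl.
by rewrite mulr_ge0_le0// subr_le0.
Qed.

Lemma multiplier_le_total_risk : mu * C <= total_risk.
Proof.
rewrite -constraint mulr_sumr; apply: ler_sum => i _.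
by rewrite mulrA -slope_eq; exact: slope_mul_le_bayes_risk.
Qed.

Lemma total_risk_ge0 : 0 <= total_risk.
Proof. by apply: sumr_ge0 => i _; exact: bayes_risk_ge0. Qed.

(** Spending the whole budget on one coordinate is feasible in the saddle inequality; the other
    coordinates keep a nonnegative risk at 0. *)
Lemma total_risk_ge_single (i : 'I_n) : bayes_risk v u (C / A i) <= total_risk.
Proof.
pose r j := if j == i then C / A i else 0.
have r0 j : 0 <= r j by rewrite /r; case: ifP => // _; rewrite divr_ge0// ltW.
apply: le_trans (total_risk_saddle r0 _).
- rewrite [leRHS](bigD1 i)//= /r eqxx ler_wpDr//.
    apply: sumr_ge0 => j ji; rewrite (negbTE ji) coord_risk_affine sub0r mulrN subr_ge0.
    exact: slope_mul_le_bayes_risk.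
  rewrite coord_risk_affine; apply: bayes_risk_le_tangent => //.
  by rewrite divr_ge0// ltW.
- rewrite (bigD1 i)//= /r eqxx big1 ?addr0; last first.
    by move=> j /negbTE ->; rewrite mulr0.
  by rewrite mulrC divfK// gt_eqF.
Qed.

Variable e : R.
Hypothesis e01 : 0 < e <= 2^-1.

Lemma shrunk_prior_risk_off_ellipsoid (r : 'I_n -> R) : (forall i, 0 <= r i) ->
  C < \sum_(i < n) A i * r i ->
  \sum_(i < n) coord_risk v u ((1 - e) * t i) (r i) + 1 <=
  (5 * total_risk + 1) / (e * C) ^+ 2 *
  (\sum_(i < n) A i * r i - \sum_(i < n) A i * ((1 - e) * t i)) ^+ 2.
Proof.
move=> r0; case/andP: (e01) => e0 e1.
have e01' : 0 <= e <= 1 by apply/andP; split; lra.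
have e02 : 0 <= e <= 2^-1 by apply/andP; split; lra.
set T := \sum_(i < n) A i * r i => CT.
have -> : \sum_(i < n) A i * ((1 - e) * t i) = (1 - e) * C.
  by rewrite -constraint mulr_sumr; apply: eq_bigr => i _; ring.
have V0 := total_risk_ge0; have muC := multiplier_le_total_risk.
(* The 4 is the slope loss from shrinking. Since [mu * C] is at most the total risk, the linear term
   costs four total risks, and the constant term makes it five. *)
have h1 : \sum_(i < n) coord_risk v u ((1 - e) * t i) (r i) <=
    total_risk + 4 * (mu * T).
  rewrite /T !mulr_sumr -big_split/=; apply: ler_sum => i _.
  have st0 : 0 <= (1 - e) * t i by rewrite mulr_ge0//; lra.
  rewrite coord_risk_affine lerD ?bayes_risk_le//.
  have g1 := risk_slope_shrink v0 u0 (t0 i) e02.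
  have g2 := slope_le i.
  have g3 : risk_slope v u ((1 - e) * t i) * r i <= 4 * (mu * A i) * r i.
    by rewrite ler_wpM2r//; lra.
  have g4 : 0 <= risk_slope v u ((1 - e) * t i) * ((1 - e) * t i).
    by rewrite mulr_ge0// risk_slope_ge0.
  lra.
clearbody T.
have eC : 0 < (e * C) ^+ 2 by rewrite exprn_gt0// mulr_gt0.
rewrite mulrAC ler_pdivlMr//.
have [k1 k2] := excess_sqr_le C0 e0 e1 CT.
move: k1 k2 eC; set E := (e * C) ^+ 2; set Z : R := (_ - _) ^+ 2 => k1 k2 eC.
have Z0 : 0 <= Z by rewrite sqr_ge0.
clearbody E Z.
have k3 : mu * (E * T) <= mu * (C * Z) by rewrite ler_wpM2l.
have k4 : mu * C * Z <= total_risk * Z by rewrite ler_wpM2r.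
have k5 : (total_risk + 1) * E <= (total_risk + 1) * Z by rewrite ler_wpM2l//; lra.
apply: (@le_trans _ _ ((total_risk + 4 * (mu * T) + 1) * E)).
  by apply: ler_wpM2r; [exact: ltW|rewrite lerD2r].
lra.
Qed.

Lemma shrunk_prior_risk_ge :
  (1 - e) * total_risk <=
  \sum_(i < n) coord_risk v u ((1 - e) * t i) ((1 - e) * t i).
Proof.
rewrite /total_risk mulr_sumr; apply: ler_sum => i _.
by apply: bayes_risk_shrink => //; case/andP: e01 => ? ?; apply/andP; split; lra.
Qed.

End least_favorable.

(** * Minimax and linear minimax risks *)

Section sandwich.
Context {R : realType}.
Variables (n m : nat) (a : nat -> R) (C lam : R).
Hypotheses (n0 : (0 < n)%N) (m0 : (0 < m)%N) (C0 : 0 < C) (a0 : forall i, 0 < a i).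
Hypothesis lamC : \sum_(i < n) a i ^+ 2 * bracket a n m lam i = 2 * C.

Local Notation v := (@noise_var R n).
Local Notation u := (@noise_var R m).

Let v0 : 0 < v. Proof. by rewrite invr_gt0 ltr0n. Qed.
Let u0 : 0 < u. Proof. by rewrite invr_gt0 ltr0n. Qed.

(** Precisions add, so this is the second root parameter in [risk_slopeE]. *)
Let pooled : @noise_var R (n + m) = u * v / (u + v).
Proof.
rewrite /noise_var natrD; field.
by rewrite -natrD !pnatr_eq0 -!lt0n addn_gt0 n0 m0.
Qed.

Local Notation theta i := (theta_sq a n m lam i).

Let theta_ge0 i : 0 <= theta i.
Proof. by rewrite mulr_ge0// le_max lexx orbT. Qed.

Let constraint : \sum_(i < n) a i ^+ 2 * theta i = C.
Proof.
rewrite /theta_sq; transitivity (2^-1 * \sum_(i < n) a i ^+ 2 * bracket a n m lam i).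
  by rewrite mulr_sumr; apply: eq_bigr => i _; rewrite mulrCA.
by rewrite lamC mulKf.
Qed.

Local Notation w := (v - @noise_var R (n + m)).

Let wE : w = v ^+ 2 / (u + v).
Proof. by rewrite pooled; field; rewrite gt_eqF// addr_gt0. Qed.

Let w0 : 0 < w. Proof. by rewrite wE divr_gt0 ?exprn_gt0 ?addr_gt0. Qed.

Let v'0 : 0 < @noise_var R (n + m).
Proof. by rewrite invr_gt0 ltr0n addn_gt0 n0. Qed.

(** For [lam <= 0] the square root is at most 1, every bracket vanishes, and the sum cannot reach
    [2 * C]. *)
Lemma multiplier_gt0 : 0 < lam.
Proof.
rewrite ltNge; apply/negP => lam0.
suff : \sum_(i < n) a i ^+ 2 * bracket a n m lam i <= 0.
  by rewrite lamC leNgt mulr_gt0.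
apply: sumr_le0 => i _; rewrite mulr_ge0_le0 ?sqr_ge0//.
rewrite /bracket ge_max lexx andbT subr_le0.
have s1 : Num.sqrt (1 + (4 * lam / a i ^+ 2) / w) <= 1.
  rewrite -[leRHS]sqrtr1 ler_wsqrtr// gerDl.
  apply: mulr_le0_ge0; last by rewrite invr_ge0 ltW.
  by apply: mulr_le0_ge0; [rewrite mulr_ge0_le0|rewrite invr_ge0 sqr_ge0].
apply: (@le_trans _ _ w); first by rewrite ler_piMr// ltW.
by have := v'0; lra.
Qed.

(** With this multiplier, stationarity reads: the product of the two linear factors in [risk_slopeE]
    equals [lam * w / a i ^+ 2]. *)
Local Notation mu := ((2 * lam)^-1).

Let mu0 : 0 < mu. Proof. by rewrite invr_gt0 mulr_gt0// multiplier_gt0. Qed.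

Lemma theta_sq_kkt i :
  risk_slope v u (theta i) <= mu * a i ^+ 2 /\
  risk_slope v u (theta i) * theta i = mu * a i ^+ 2 * theta i.
Proof.
rewrite risk_slopeE// -pooled.
have l0 := multiplier_gt0; have ai := a0 i.
have aa : 0 < a i ^+ 2 by rewrite exprn_gt0.
rewrite /theta_sq /bracket/=.
move: w0 v'0; have -> : v = w + @noise_var R (n + m) by rewrite subrK.
rewrite addrK; move: w => W W0; move: (@noise_var R (n + m)) => z z0.
set S := W * Num.sqrt _.
have S0 : 0 <= S by rewrite mulr_ge0 ?sqrtr_ge0// ltW.
have SS : S ^+ 2 = W ^+ 2 + 4 * (lam * W / a i ^+ 2).
  rewrite exprMn sqr_sqrtr; last by rewrite addr_ge0// !divr_ge0// ?mulr_ge0// ltW.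
  by field; rewrite !gt_eqF.
clearbody S.
have lA : 0 < lam * W / a i ^+ 2 by rewrite divr_gt0// mulr_gt0.
have eqA : mu * a i ^+ 2 = W / 2 / (lam * W / a i ^+ 2).
  by field; rewrite !gt_eqF.
(* If the bracket is cut to 0, [S <= W + 2 * z] squares to the slope inequality at 0. Otherwise the
   linear factors are [(S + W) / 2] and [(S - W) / 2], and the slope condition holds with
   equality. *)
case: (leP (S - (W + z + z)) 0) => Sle.
  rewrite mulr0 !add0r !mulr0; split => //.
  have pp : 0 < (W + z) * z by rewrite mulr_gt0 ?addr_gt0.
  rewrite eqA ler_pM2l; last by rewrite divr_gt0.
  rewrite lef_pV2 ?posrE//.
  have : S ^+ 2 <= (W + z + z) ^+ 2 by rewrite ler_sqr ?nnegrE//; lra.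
  by rewrite SS; lra.
have -> : (2^-1 * (S - (W + z + z)) + (W + z)) * (2^-1 * (S - (W + z + z)) + z)
   = lam * W / a i ^+ 2.
  apply: (@mulfI _ 4) => //.
  transitivity (S ^+ 2 - W ^+ 2); first by field.
  by rewrite SS; ring.
by rewrite -eqA.
Qed.

Local Notation t_ := (fun i : 'I_n => theta i).
Local Notation A_ := (fun i : 'I_n => a i ^+ 2).

Definition optimal_risk : R := total_risk v u t_.

Lemma optimal_risk_ge : bayes_risk v u (C / a 0 ^+ 2) <= optimal_risk.
Proof.
apply: (@total_risk_ge_single _ n v u C mu A_ t_ v0 u0 C0 (ltW mu0)
  _ _ _ _ _ (Ordinal n0)) => //.
- by move=> i; rewrite exprn_gt0.
- by move=> i; have [] := theta_sq_kkt i.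
- by move=> i; have [] := theta_sq_kkt i.
Qed.

Let s_of (r : 'I_n -> R) : @Rvec R n := [tuple r i | i < n].

Lemma kl_risk_linear_density (s th : @Rvec R n) : (forall i, 0 <= (tnth s i : R)) ->
  kl_risk m th (linear_density m s) = (m%:R^-1 * bayes_pred_risk s v u th)%:E.
Proof.
move=> s0; rewrite /kl_risk EFinM -(integral_log_bayes_pred s0 v0 u0).
congr (_ * _)%E; apply: eq_integral => z _; congr (lne (_ / _%:E))%E.
exact: bayes_predE.
Qed.

Lemma minimax_risk_le_linear : (minimax_risk a C n m <= linear_minimax_risk a C n m)%E.
Proof.
apply: le_ereal_inf => _ [s s0 <-]; exists (linear_density m s) => //.
rewrite (_ : linear_density m s = bayes_pred s v u).
  exact: predictive_bayes_pred.
by apply/funext => x; apply/funext => y; exact: bayes_predE.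
Qed.

Lemma linear_minimax_risk_le :
  (linear_minimax_risk a C n m <= (m%:R^-1 * optimal_risk)%:E)%E.
Proof.
have s0 i : 0 <= (tnth (s_of t_) i : R) by rewrite tnth_mktuple.
apply: (@le_trans _ _ (ereal_sup [set kl_risk m th (linear_density m (s_of t_))
                           | th in @ellipsoid R a C n])).
  by apply: ereal_inf_lbound; exists (s_of t_).
apply: ge_ereal_sup => _ [th thC <-].
rewrite kl_risk_linear_density// lee_fin ler_wpM2l ?invr_ge0//.
rewrite /bayes_pred_risk; under eq_bigr do rewrite tnth_mktuple.
apply: (@total_risk_saddle _ n v u C mu A_ t_ (ltW mu0)) => //.
- by move=> i; have [] := theta_sq_kkt i.
- by move=> i; have [] := theta_sq_kkt i.
- by move=> i; exact: sqr_ge0.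
Qed.

(** A predictive density with maximal risk below [L / m] would contradict [bayes_lower_bound] for
    the prior with variances [(1 - e) * theta i]. *)
Lemma minimax_risk_ge (e : R) : 0 < e <= 2^-1 ->
  let L := (1 - e) * optimal_risk -
    (5 * optimal_risk + 1) / (e * C) ^+ 2 *
      (32 * \sum_(i < n) a i ^+ 4 * theta i ^+ 2) in
  0 < L -> ((m%:R^-1 * L)%:E <= minimax_risk a C n m)%E.
Proof.
move=> e01 L L0; apply: le_ereal_inf_tmp => _ [q pq <-].
set S := ereal_sup _; rewrite leNgt; apply/negP => SL.
have mi0 : 0 < m%:R^-1 :> R by exact: u0.
(* The supremum is replaced by a nonnegative real bound; truncation at 0 stays below [L] because [L]
   is positive. *)
have [M [M0 ML SM]] : exists M, [/\ 0 <= M, M < L & (S <= (m%:R^-1 * M)%:E)%E].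
  move: SL; case: S => [r| |] // SL; last by exists 0; rewrite leNye; split.
  move: SL; rewrite lte_fin => SL.
  exists (Num.max 0 (m%:R * r)); split.
  - by rewrite le_max lexx.
  - by rewrite gt_max L0/= -ltr_pdivlMl// ltr0n.
  - rewrite lee_fin -ler_pdivrMl// invrK le_max; by rewrite lexx orbT.
pose s := s_of (fun i => (1 - e) * theta i).
have e0 : 0 < e by case/andP: e01.
have e1 : 0 <= 1 - e by case/andP: e01 => _; lra.
have sE i : tnth s i = (1 - e) * theta i by rewrite tnth_mktuple.
have s0 i : 0 <= (tnth s i : R) by rewrite sE mulr_ge0.
have A0 (i : 'I_n) : 0 < a i ^+ 2 by rewrite exprn_gt0.
have K1 (i : 'I_n) : risk_slope v u (theta i) <= mu * a i ^+ 2.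
  by have [] := theta_sq_kkt i.
have K2 (i : 'I_n) : risk_slope v u (theta i) * theta i = mu * a i ^+ 2 * theta i.
  by have [] := theta_sq_kkt i.
have V0 : 0 <= optimal_risk by exact: total_risk_ge0.
have Q0 : 0 <= \sum_(i < n) a i ^+ 4 * theta i ^+ 2.
  by apply: sumr_ge0 => i _; rewrite mulr_ge0 ?sqr_ge0 ?exprn_even_ge0.
have eC : 0 < (e * C) ^+ 2 by rewrite exprn_gt0// mulr_gt0.
have K0 : 0 <= (5 * optimal_risk + 1) / (e * C) ^+ 2.
  by rewrite divr_ge0 ?(ltW eC)//; lra.
have := @bayes_lower_bound R n s v u s0 v0 u0 A_ (@ellipsoid R a C n) q M _
  (fun i => ltW (A0 i)) pq M0 K0.
have h1 th : @ellipsoid R a C n th ->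
  (\int[gauss_law th v \x gauss_law th u]_z
      lne ((gauss_pdf th u z.2)%:E / (q z.1 z.2)%:E) <= M%:E)%E.
  move=> thC; have : (kl_risk m th q <= (m%:R^-1 * M)%:E)%E.
    by apply: le_trans SM; apply: ereal_sup_ubound; exists th.
  by rewrite /kl_risk EFinM lee_pmul2l.
have h2 th : ~ @ellipsoid R a C n th -> bayes_pred_risk s v u th + 1 <=
    (5 * optimal_risk + 1) / (e * C) ^+ 2 *
    (\sum_(i < n) a i ^+ 2 * tnth th i ^+ 2 -
     \sum_(i < n) a i ^+ 2 * tnth s i) ^+ 2.
  move=> /negP; rewrite -ltNge => thC.
  rewrite /bayes_pred_risk.
  under eq_bigr => i _ do rewrite sE.
  have -> : \sum_(i < n) a i ^+ 2 * tnth s i =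
      \sum_(i < n) a i ^+ 2 * ((1 - e) * theta i).
    by apply: eq_bigr => i _; rewrite sE.
  apply: (@shrunk_prior_risk_off_ellipsoid _ n v u C mu A_ t_ v0 u0 C0 (ltW mu0)
    (fun i => theta_ge0 i) K1 K2 constraint e e01 (fun i => tnth th i ^+ 2)) => //.
  by move=> i; exact: sqr_ge0.
move=> /(_ h1 h2).
under eq_bigr => i _ do rewrite !sE.
have -> : \sum_(i < n) (a i ^+ 2) ^+ 2 * tnth s i ^+ 2 =
          \sum_(i < n) (a i ^+ 2) ^+ 2 * ((1 - e) * theta i) ^+ 2.
  by apply: eq_bigr => i _; rewrite sE.
have h3 := @shrunk_prior_risk_ge _ n v u t_ v0 u0 (fun i => theta_ge0 i) e e01.
have h4 : \sum_(i < n) (a i ^+ 2) ^+ 2 * ((1 - e) * theta i) ^+ 2 <=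
          \sum_(i < n) a i ^+ 4 * theta i ^+ 2.
  apply: ler_sum => i _; rewrite -exprM ler_wpM2l ?exprn_even_ge0//.
  have ti : (1 - e) * theta i <= theta i.
    by rewrite ler_piMl // lerBlDl lerDr ltW.
  have tr : 0 <= (1 - e) * theta i by apply: mulr_ge0.
  have tg := theta_ge0 i.
  by apply: lerXn2r; rewrite ?nnegrE.
have h5 : (5 * optimal_risk + 1) / (e * C) ^+ 2 *
    (32 * \sum_(i < n) (a i ^+ 2) ^+ 2 * ((1 - e) * theta i) ^+ 2) <=
   (5 * optimal_risk + 1) / (e * C) ^+ 2 *
      (32 * \sum_(i < n) a i ^+ 4 * theta i ^+ 2).
  by rewrite ler_wpM2l// ler_wpM2l.
move=> h6; have : L <= M.
  have h7 := le_trans h3 h6.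
  rewrite /L lerBlDr; apply: (le_trans h7); by rewrite lerD2l.
by rewrite leNgt ML.
Qed.

End sandwich.

(** * Uniform lower bound on the risk and passage to the limit *)

Lemma bayes_risk_ge_of_noise_le (R : realType) (n m : nat) (t : R) :
  (0 < n)%N -> (n <= m)%N -> noise_var n <= t ->
  2^-1 * ln (3 / 2) <= bayes_risk (noise_var n) (noise_var m) t.
Proof.
move=> n0 nm tn; have m0 : (0 < m)%N := leq_trans n0 nm.
have v0 : 0 < noise_var n :> R by rewrite invr_gt0 ltr0n.
have u0 : 0 < noise_var m :> R by rewrite invr_gt0 ltr0n.
have uv : noise_var m <= noise_var n :> R by rewrite lef_pV2 ?posrE ?ltr0n// ler_nat.
have t0 : 0 < t by exact: lt_le_trans tn.
have pv0 : 0 < predictive_var (noise_var n) (noise_var m) t.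
  by apply: predictive_var_gt0 => //; exact: ltW.
rewrite bayes_riskE; [|by []|by []|exact: ltW].
rewrite ler_wpM2l ?invr_ge0// ler_ln ?posrE ?divr_gt0//.
rewrite ler_pdivlMr// /predictive_var.
(* The 3/2 arises here: the shrinkage factor is at least one half and [noise_var n >= noise_var m],
   so the predictive variance is at least [noise_var m / 2 + noise_var m]. *)
have h : 2^-1 <= shrink (noise_var n) t.
  by rewrite /shrink ler_pdivlMr ?addr_gt0//; lra.
have : 2^-1 * noise_var m <= shrink (noise_var n) t * noise_var n.
  by apply: ler_pM => //; apply: ltW.
lra.
Qed.

Lemma ereal_ratio_bounds (R : realType) (r l : \bar R) (p P : R) :
  0 < p -> (p%:E <= r)%E -> (r <= l)%E -> (l <= P%:E)%E ->
  exists2 x, (r / l)%E = x%:E & p / P <= x <= 1.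
Proof.
move=> p0 pr rl lP.
move: l rl lP => [l| |]//; last by move: r pr => [].
move: r pr => [r| |]//; rewrite !lee_fin => pr rl lP.
have r0 : 0 < r by exact: lt_le_trans pr.
have l0 : 0 < l by exact: lt_le_trans rl.
have P0 : 0 < P by exact: lt_le_trans lP.
exists (r / l); first by rewrite inver gt_eqF.
apply/andP; split; last by rewrite ler_pdivrMr// mul1r.
apply: ler_pM => //; [exact: ltW|by rewrite invr_ge0 ltW|].
by rewrite lef_pV2.
Qed.

Theorem theorem4p2 (R : realType) (C : R) (a : nat -> R) (m : nat -> nat)
    (lam : nat -> R)
    (C_gt0 : 0 < C)
    (a_gt0 : 0 < a 0%N)
    (a_nondecreasing : forall i, a i <= a i.+1)
    (a_cvg : a @ \oo --> +oo)
    (n_le_m : forall n, (n <= m n)%N)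
    (lam_sol : forall n, (0 < n)%N ->
      \sum_(i < n) a i ^+ 2 * bracket a n (m n) (lam n) i = 2 * C)
    (m_bigO : (fun n => (m n)%:R : R) =O_\oo (fun n => n%:R : R))
    (small : (fun n => ln (1 / noise_var n) *
        \sum_(i < n) a i ^+ 4 * theta_sq a n (m n) (lam n) i ^+ 2 : R)
      =o_\oo (fun=> 1 : R)) :
  (minimax_risk a C n (m n) / linear_minimax_risk a C n (m n))%E
    @[n --> \oo] --> 1%:E.
Proof.
have a_pos i : 0 < a i.
  by elim: i => // i ih; exact: lt_le_trans (a_nondecreasing i).
pose Q n := \sum_(i < n) a i ^+ 4 * theta_sq a n (m n) (lam n) i ^+ 2.
have Q0 n : 0 <= Q n.
  by apply: sumr_ge0 => i _; rewrite mulr_ge0 ?sqr_ge0 ?exprn_even_ge0.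
(* Once [n] exceeds [expR 1] the logarithm is at least 1, so the small product bounds [Q n]
   itself. *)
have Q_small (eta : R) : 0 < eta -> \forall n \near \oo, Q n <= eta.
  move=> eta0; move/eqoP : small => /(_ eta eta0) h.
  near=> n.
  have n1 : expR 1 <= n%:R :> R by near: n; exact: nbhs_infty_ger.
  have ln1n : 1 <= ln (1 / noise_var n) :> R.
    rewrite /noise_var div1r invrK -[leLHS]expRK ler_ln ?posrE ?expR_gt0//.
    by apply: lt_le_trans n1; exact: expR_gt0.
  have : `|ln (1 / noise_var n) * Q n| <= eta * `|1 : R| by near: n; exact: h.
  rewrite normr1 mulr1; apply: le_trans; apply: le_trans (ler_norm _).
  by rewrite ler_peMl.
pose t := C / a 0%N ^+ 2.
have t0 : 0 < t by rewrite divr_gt0// exprn_gt0.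
pose c : R := 2^-1 * ln (3 / 2).
have c0 : 0 < c by rewrite mulr_gt0// ln_gt0//; lra.
pose ratio n := (minimax_risk a C n (m n) / linear_minimax_risk a C n (m n))%E.
have main (eps : R) : 0 < eps -> eps < 1 -> \forall n \near \oo,
    exists2 x : R, ratio n = x%:E
      & 1 - eps <= x <= 1.
  (* Half of [eps] pays for shrinking the prior, the other half for the variance term. *)
  move=> eps0 eps1; pose e := eps / 2.
  have e01 : 0 < e <= 2^-1 by apply/andP; split; rewrite /e; lra.
  have e0 : 0 < e by case/andP: e01.
  (* As [V >= c], the factor [5 * V + 1] is at most [(5 + c^-1) * V], which makes the variance term
     at most [k * V * Q n]. *)
  pose k := 32 * (5 + c^-1) / (e * C) ^+ 2.
  have k0 : 0 < k.
    rewrite divr_gt0 ?exprn_gt0 ?mulr_gt0 ?addr_gt0 ?invr_gt0//.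
  have ek0 : 0 < eps / 2 / k by apply: divr_gt0 => //; exact: divr_gt0.
  near=> n.
  have n0 : (0 < n)%N by near: n; exact: nbhs_infty_gt.
  have m0 := leq_trans n0 (n_le_m n).
  have nt : noise_var n <= t.
    rewrite /noise_var -[leRHS]invrK lef_pV2 ?posrE ?ltr0n ?invr_gt0//.
    by near: n; exact: nbhs_infty_ger.
  have Qn : Q n <= eps / 2 / k by near: n; exact: Q_small.
  pose V := optimal_risk n (m n) a (lam n).
  have cV : c <= V.
    apply: le_trans (optimal_risk_ge n0 m0 C_gt0 a_pos (lam_sol n n0)).
    exact: bayes_risk_ge_of_noise_le.
  have V0 : 0 < V by exact: lt_le_trans cV.
  pose L := (1 - e) * V - (5 * V + 1) / (e * C) ^+ 2 * (32 * Q n).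
  have LV : (1 - eps) * V <= L.
    have h1 : (5 * V + 1) / (e * C) ^+ 2 * (32 * Q n) <= k * V * Q n.
      rewrite /k (_ : _ * V * Q n = (5 * V + V / c) / (e * C) ^+ 2 * (32 * Q n)).
        rewrite ler_wpM2r ?mulr_ge0// ler_wpM2r ?invr_ge0 ?sqr_ge0// lerD2l.
        by rewrite ler_pdivlMr// mul1r.
      by field; rewrite !gt_eqF//.
    have h2 : k * V * Q n <= k * V * (eps / 2 / k) by rewrite ler_wpM2l// mulr_ge0// ltW.
    have h3 : k * V * (eps / 2 / k) = eps / 2 * V by field; rewrite gt_eqF.
    rewrite /L lerBrDr (_ : (1 - e) * V = (1 - eps) * V + eps / 2 * V).
      by rewrite lerD2l -h3; exact: le_trans h2.
    by rewrite /e; field.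
  have L0 : 0 < L by apply: lt_le_trans LV; rewrite mulr_gt0//; lra.
  have mi0 : 0 < (m n)%:R^-1 :> R by rewrite invr_gt0 ltr0n.
  have [x xE xb] := ereal_ratio_bounds (mulr_gt0 mi0 L0)
    (minimax_risk_ge n0 m0 C_gt0 a_pos (lam_sol n n0) e01 L0)
    (minimax_risk_le_linear _ _ n0 m0)
    (linear_minimax_risk_le n0 m0 C_gt0 a_pos (lam_sol n n0)).
  exists x => //; case/andP: xb => xl xu; rewrite xu andbT.
  apply: le_trans xl; rewrite ler_pdivlMr ?mulr_gt0// mulrCA.
  by rewrite ler_wpM2l// ltW.
apply/fine_cvgP; split.
  have h : 0 < (2^-1 : R) < 1 by apply/andP; split; lra.
  case/andP: h => h0 h1.
  near=> n; rewrite -/(ratio n).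
  have [x -> _] : exists2 x : R, ratio n = x%:E
      & 1 - 2^-1 <= x <= 1 by near: n; exact: main.
  by [].
apply/cvgrPdist_le => eps eps0.
(* The cap keeps the tolerance below 1, as [main] requires. *)
pose d := Num.min eps 2^-1.
have d0 : 0 < d by rewrite lt_min eps0/= invr_gt0.
have d1 : d < 1 by rewrite gt_min; apply/orP; right; lra.
near=> n.
have [x xE /andP[xl xu]] : exists2 x : R, ratio n = x%:E
      & 1 - d <= x <= 1 by near: n; exact: main.
rewrite /= -/(ratio n) xE /= ger0_norm ?subr_ge0//.
have : d <= eps by rewrite ge_min lexx.
lra.
Unshelve. all: by end_near.
Qed.
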